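(* Let $\varphi$ be a holomorphic self-map of $\mathbb{D}$ and let $\psi\in H^\infty(\mathbb{D})$. Let $p\in\mathbb{D}$ and $\lambda\in\mathbb{C}$ with $|\lambda|=1$ and $\lambda p=\overline{p}$, and put $$\sigma(z)=\lambda\frac{p-z}{1-\overline{p}z},\qquad k_p(z)=\frac{\sqrt{1-|p|^2}}{1-\overline{p}z}.$$ Then the operator $W_{\psi,\varphi}$ on $H^2(\mathbb{D})$ is complex symmetric under the conjugation $\mathcal{J}W_{k_p,\sigma}$ if and only if, for some constants $a_0,a_1,c\in\mathbb{C}$, $$\psi(z)=\frac{c}{1-a_0p-(p-\overline{\lambda}a_0)z}\quad\text{and}\quad \varphi(z)=a_0+\frac{a_1(p-\overline{\lambda}z)}{1-a_0p-(p-\overline{\lambda}a_0)z}.$$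
   Context: $\mathbb{D}$ is the open unit disk in $\mathbb{C}$; $H^2(\mathbb{D})$ is the classical Hardy–Hilbert space on $\mathbb{D}$; $H^\infty(\mathbb{D})$ is the space of bounded holomorphic functions on $\mathbb{D}$. For $\psi$ holomorphic on $\mathbb{D}$ and $\varphi$ a holomorphic self-map of $\mathbb{D}$, the weighted composition operator is $W_{\psi,\varphi}f=\psi\cdot(f\circ\varphi)$. A conjugation on a complex Hilbert space is an anti-linear, isometric map $\mathcal{C}$ with $\mathcal{C}^2=I$. A bounded operator $T$ is complex symmetric under (with) the conjugation $\mathcal{C}$ if $\mathcal{C}T=T^*\mathcal{C}$. $\mathcal{J}$ is the conjugation on $H^2(\mathbb{D})$ given by $\mathcal{J}(\sum_{n\ge0}a_nz^n)=\sum_{n\ge0}\overline{a_n}z^n$. With $\lambda p=\overline{p}$ (that is, $\lambda=\overline{p}/p$ if $p\ne0$, and $\lambda$ any unimodular constant if $p=0$), the composition $\mathcal{J}W_{k_p,\sigma}$ is a conjugation on $H^2(\mathbb{D})$.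
   Formalization: It is additionally assumed that ψ is not identically zero on the disk (for ψ = 0 the operator is zero and φ can be arbitrary, e.g. φ(z) = z², so the claim fails), and the common denominator is explicitly required not to vanish on the disk. *)

(* Defs.v *)
(* Stdlib real numbers with Coquelicot's complex numbers [C]. *)
From Stdlib Require Import Reals ClassicalEpsilon.
From Coquelicot Require Import Coquelicot.

Open Scope R_scope.
Open Scope C_scope.

Definition disk (z : C) : Prop := (Cmod z < 1)%R.

(* A function on the disk is represented by a total function [C -> C] of which
   only the values on the disk matter; equality of such functions is [f =D g]. *)
Definition eq_on_disk (f g : C -> C) : Prop :=
  forall z : C, disk z -> f z = g z.

Notation "f =D g" := (eq_on_disk f g) (at level 70, no associativity).

Definition holomorphic (f : C -> C) : Prop :=
  forall z : C, disk z -> ex_derive f z.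

Definition holomorphic_self_map (phi : C -> C) : Prop :=
  holomorphic phi /\ forall z : C, disk z -> disk (phi z).

Definition Hinfty (psi : C -> C) : Prop :=
  holomorphic psi /\
  exists M : R, forall z : C, disk z -> (Cmod (psi z) <= M)%R.

Definition has_power_series (f : C -> C) (a : nat -> C) : Prop :=
  forall z : C, disk z -> is_pseries a z (f z).

(* Unspecified when [f] has no power series on the disk. *)
Definition taylor (f : C -> C) : nat -> C :=
  epsilon (inhabits (fun _ : nat => RtoC 0)) (has_power_series f).

(* Membership in the Hardy-Hilbert space of the disk. *)
Definition H2 (f : C -> C) : Prop :=
  exists a : nat -> C,
    has_power_series f a /\ ex_series (fun n => (Cmod (a n) ^ 2)%R).

(* Coquelicot's [Series] is real-valued; this is the sum of a convergent complex
   series. *)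
Definition CSeries (a : nat -> C) : C :=
  (Series (fun n => Re (a n)), Series (fun n => Im (a n))).

Definition inner (f g : C -> C) : C :=
  CSeries (fun n => taylor f n * Cconj (taylor g n)).

Definition normH2 (f : C -> C) : R := sqrt (Re (inner f f)).

(* Neither this definition nor [is_adjoint] and [conjugation] below asks
   separately that [=D] be respected: the norm, resp. inner product, conditions
   force it, so they describe genuine maps of the Hilbert space. *)
Definition bounded_operator (T : (C -> C) -> (C -> C)) : Prop :=
  (forall f, H2 f -> H2 (T f)) /\
  (forall (a : C) f g, H2 f -> H2 g ->
     T (fun z => a * f z + g z) =D (fun z => a * T f z + T g z)) /\
  (exists M : R, forall f, H2 f -> (normH2 (T f) <= M * normH2 f)%R).

Definition is_adjoint (T S : (C -> C) -> (C -> C)) : Prop :=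
  (forall f, H2 f -> H2 (S f)) /\
  (forall f g, H2 f -> H2 g -> inner (T f) g = inner f (S g)).

Definition conjugation (K : (C -> C) -> (C -> C)) : Prop :=
  (forall f, H2 f -> H2 (K f)) /\
  (forall (a : C) f g, H2 f -> H2 g ->
     K (fun z => a * f z + g z) =D (fun z => Cconj a * K f z + K g z)) /\
  (forall f, H2 f -> normH2 (K f) = normH2 f) /\
  (forall f, H2 f -> K (K f) =D f).

(* [S] is the adjoint of [T], which exists and is unique (up to [=D]) for a
   bounded operator [T]. *)
Definition complex_symmetric (K T : (C -> C) -> (C -> C)) : Prop :=
  conjugation K /\ bounded_operator T /\
  exists S, is_adjoint T S /\ forall f, H2 f -> K (T f) =D S (K f).

Definition W (psi phi : C -> C) (f : C -> C) : C -> C :=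
  fun z => psi z * f (phi z).

Definition J (f : C -> C) : C -> C :=
  fun z => CSeries (fun n => Cconj (taylor f n) * z ^ n).

Definition disk_auto (lam p : C) : C -> C :=
  fun z => lam * ((p - z) / (1 - Cconj p * z)).

Definition kernel (p : C) : C -> C :=
  fun z => RtoC (sqrt (1 - Cmod p ^ 2)) / (1 - Cconj p * z).

(* Main.v *)
Require Import Defs.
From Stdlib Require Import Reals Lra Lia ClassicalEpsilon FunctionalExtensionality.
From Coquelicot Require Import Coquelicot.
Open Scope R_scope.
Open Scope C_scope.

(** Write [K] for the map [J W_(k_p, sigma)] and [szego w] for the reproducing
    kernel [1 / (1 - Cconj w * z)], so that [inner f (szego w) = f w].  A direct
    computation gives [K (szego w) z = s_p / den w z] with
    [den w z = 1 - w p - p z + Cconj lam w z], which is symmetric in [w] and [z].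
    For a conjugation, [(f, g) |-> inner f (K g)] is a symmetric bilinear form,
    and [W psi phi] is complex symmetric exactly when it is symmetric for this
    form.  Testing on the functions [K (szego w)], on which the form is point
    evaluation, turns the property into the functional equation
    [psi v * den v (phi w) = psi w * den w (phi v)] ([symmetric_symbols]).

    Solving the equation: since [lam p = Cconj p], the function [den (Cconj p)]
    is constant.  Hence [w = Cconj p] determines [psi] in terms of
    [a0 = phi (Cconj p)], and then any single [v] with [p <> Cconj lam v]
    determines [phi] ([symmetric_symbols_form]).

    The converse rests on four facts about the Hardy space.

    - Multiplication by a linear-fractional map [N / D] bounded by 1 on the disk
      is a contraction ([linear_fractional_contractive]).  With
      [t = inner (z g) g], the difference of the squared norms of [N g] and
      [D g] is affine in [t], and [|N| <= |D|] on the circle says that it is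
      nonpositive for every [t] allowed by the Cauchy-Schwarz inequality.
    - If moreover [tau b = 0], then [f |-> szego b * (f o tau)] is bounded
      ([weighted_composition_bound]).  This is Littlewood's argument: [szego b]
      is orthogonal to every multiple of [tau], so one can peel off one Taylor
      coefficient at a time; completeness passes from polynomials to [f].
    - With [tau = sigma], [b = p] this makes [K] a contraction, and a contraction
      which is an involution is an isometry ([conj_op_conjugation]).  For the
      given [psi] and [phi], composing [phi] with the automorphism that moves
      [phi 0] to 0 gives the case [b = 0], whence the boundedness of
      [W psi phi] ([linear_fractional_W_bounded]).
    - A bounded functional which vanishes on all kernels vanishes
      ([kernels_total]).  This extends [inner (W psi phi f) g = inner f (S g)],
      where [S = K (W psi phi) K], from kernels [g] to the whole space. *)

(** * Complex series *)

Definition sums (u : nat -> C) (l : C) : Prop :=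
  @is_series C_AbsRing C_NormedModule u l.

Lemma sums_Re u l : sums u l -> is_series (fun n => Re (u n)) (Re l).
Proof.
  intros H. unfold is_series.
  apply (filterlim_ext (fun n => fst (sum_n (G := C_AbelianMonoid) u n))).
  { intros n. induction n as [|n IH].
    - now rewrite !sum_O.
    - rewrite !sum_Sn, <- IH. reflexivity. }
  eapply filterlim_comp; [exact H|].
  apply (continuous_fst (U := R_UniformSpace) (V := R_UniformSpace)).
Qed.

Lemma sums_Im u l : sums u l -> is_series (fun n => Im (u n)) (Im l).
Proof.
  intros H. unfold is_series.
  apply (filterlim_ext (fun n => snd (sum_n (G := C_AbelianMonoid) u n))).
  { intros n. induction n as [|n IH].
    - now rewrite !sum_O.
    - rewrite !sum_Sn, <- IH. reflexivity. }
  eapply filterlim_comp; [exact H|].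
  apply (continuous_snd (U := R_UniformSpace) (V := R_UniformSpace)).
Qed.

Lemma sums_CSeries u l : sums u l -> CSeries u = l.
Proof.
  intros H. unfold CSeries.
  rewrite (is_series_unique _ _ (sums_Re _ _ H)), (is_series_unique _ _ (sums_Im _ _ H)).
  now destruct l.
Qed.

Lemma sums_unique u l l' : sums u l -> sums u l' -> l = l'.
Proof. intros H H'. now rewrite <- (sums_CSeries _ _ H), (sums_CSeries _ _ H'). Qed.

Lemma sums_pair u x y :
  is_series (fun n => Re (u n)) x -> is_series (fun n => Im (u n)) y ->
  sums u (x, y).
Proof.
  intros Hx Hy. unfold sums, is_series.
  apply (filterlim_ext (fun n => (sum_n (fun k => Re (u k)) n, sum_n (fun k => Im (u k)) n))).
  { intros n. induction n as [|n IH].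
    - rewrite !sum_O. now destruct (u O).
    - rewrite !sum_Sn, <- IH. now destruct (u (S n)). }
  eapply filterlim_filter_le_2; [|exact (filterlim_pair _ _ Hx Hy)].
  intros P [eps HP]. exists (fun z => ball x eps z) (fun z => ball y eps z).
  - now exists eps.
  - now exists eps.
  - intros a b Ha Hb. apply HP. now split.
Qed.

Lemma sums_ext u v l : (forall n, u n = v n) -> sums u l -> sums v l.
Proof. apply is_series_ext. Qed.

Lemma sums_plus u v l m : sums u l -> sums v m -> sums (fun n => u n + v n) (l + m).
Proof. apply (is_series_plus (K := C_AbsRing) (V := C_NormedModule)). Qed.

Lemma sums_scal c u l : sums u l -> sums (fun n => c * u n) (c * l).
Proof. apply (is_series_scal (K := C_AbsRing) (V := C_NormedModule)). Qed.

Lemma sums_conj u l : sums u l -> sums (fun n => Cconj (u n)) (Cconj l).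
Proof.
  intros H. apply sums_pair; simpl.
  - now apply sums_Re.
  - exact (is_series_opp _ _ (sums_Im _ _ H)).
Qed.

Lemma sums_tail u l : sums u l -> sums (fun n => u (S n)) (l - u O).
Proof.
  intros H. apply (is_series_incr_1 (K := C_AbsRing) (V := C_NormedModule)).
  change (plus (l - u O)%C (u O)) with (l - u O + u O)%C.
  now replace (l - u O + u O)%C with l by ring.
Qed.

Lemma sums_cons u l : sums (fun n => u (S n)) l -> sums u (u O + l).
Proof.
  intros H. apply (is_series_decr_1 (K := C_AbsRing) (V := C_NormedModule)).
  change (plus (u O + l)%C (opp (u O))) with (u O + l + - u O)%C.
  now replace (u O + l + - u O)%C with l by ring.
Qed.

Lemma sums_abs u : ex_series (fun n => Cmod (u n)) -> sums u (CSeries u).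
Proof.
  intros H.
  destruct (ex_series_le (K := C_AbsRing) (V := C_CompleteNormedModule) u
              (fun n => Cmod (u n))) as [l Hl].
  - intros n. apply Rle_refl.
  - exact H.
  - change (sums u l) in Hl. now rewrite (sums_CSeries _ _ Hl).
Qed.

Lemma is_lim_seq_Cmod_sums u l :
  sums u l -> is_lim_seq (fun n => Cmod (sum_n (G := C_AbelianMonoid) u n)) (Cmod l).
Proof.
  intros H.
  apply (is_lim_seq_ext (fun n => norm (sum_n (G := C_NormedModule) u n))).
  { reflexivity. }
  exact (filterlim_comp _ _ _ _ _ _ _ _ H (filterlim_norm (K := C_AbsRing) l)).
Qed.

Lemma Cmod_sum_n_le u (b : nat -> R) n :
  (forall k, Cmod (u k) <= b k)%R ->
  (Cmod (sum_n (G := C_AbelianMonoid) u n) <= sum_n b n)%R.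
Proof.
  intros H. induction n as [|n IH].
  - rewrite !sum_O. apply H.
  - rewrite !sum_Sn. eapply Rle_trans; [apply Cmod_triangle|].
    apply Rplus_le_compat; [exact IH|apply H].
Qed.

Lemma sums_Cmod_le u l b m :
  sums u l -> is_series b m -> (forall n, Cmod (u n) <= b n)%R -> (Cmod l <= m)%R.
Proof.
  intros Hu Hb H.
  apply (is_lim_seq_le (fun n => Cmod (sum_n (G := C_AbelianMonoid) u n)) (sum_n b) (Cmod l) m).
  - intros n. now apply Cmod_sum_n_le.
  - now apply is_lim_seq_Cmod_sums.
  - exact Hb.
Qed.

Lemma sums_lim u l :
  sums u l <-> is_lim_seq (fun n => Cmod (sum_n (G := C_AbelianMonoid) u n - l)) 0.
Proof.
  unfold sums, is_series. rewrite (filterlim_locally_ball_norm (K := C_AbsRing) (U := C_NormedModule)).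
  rewrite <- is_lim_seq_spec.
  split; intros H eps; specialize (H eps); revert H; apply filter_imp; intros n Hn.
  - rewrite Rminus_0_r, Rabs_pos_eq by apply Cmod_ge_0. exact Hn.
  - rewrite Rminus_0_r, Rabs_pos_eq in Hn by apply Cmod_ge_0. exact Hn.
Qed.

Lemma is_lim_seq_Cmod2 u : is_lim_seq (fun n => Cmod (u n)) 0 <-> is_lim_seq (fun n => Cmod (u n) ^ 2)%R 0.
Proof.
  split; intros H.
  - replace (Finite 0) with (Finite (0 * (0 * 1))) by (f_equal; ring).
    apply is_lim_seq_mult'; [exact H|]. apply is_lim_seq_mult'; [exact H|apply is_lim_seq_const].
  - apply (is_lim_seq_ext (fun n => sqrt (Cmod (u n) ^ 2))).
    + intros n. apply sqrt_pow2, Cmod_ge_0.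
    + rewrite <- sqrt_0. apply is_lim_seq_continuous; [|exact H].
      apply continuity_pt_sqrt. lra.
Qed.

(** * Power series on the disk *)

Lemma pow_n_Cpow (z : C) n : pow_n (K := C_AbsRing) z n = (z ^ n)%C.
Proof. induction n as [|n IH]; [reflexivity|]. simpl. now rewrite IH. Qed.

Lemma is_pseries_sums a z l : is_pseries a z l <-> sums (fun n => a n * z ^ n) l.
Proof.
  assert (E : forall n, scal (pow_n (K := C_AbsRing) z n) (a n : C_NormedModule) = a n * z ^ n).
  { intros n. rewrite pow_n_Cpow. unfold scal; simpl. unfold mult; simpl. ring. }
  unfold is_pseries; split; apply sums_ext; intros n; now rewrite E.
Qed.

Lemma sums_bounded u l : sums u l -> exists M : R, forall n, (Cmod (u n) <= M)%R.
Proof.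
  intros H.
  destruct (filterlim_bounded (K := C_AbsRing) (V := C_NormedModule) _ (ex_intro _ l H)) as [M HM'].
  exists (M + M)%R. intros n.
  change (forall k, Cmod (sum_n (G := C_AbelianMonoid) u k) <= M)%R in HM'.
  destruct n as [|n].
  - generalize (HM' O). rewrite sum_O. generalize (Cmod_ge_0 (u O)). lra.
  - generalize (HM' n), (HM' (S n)). rewrite sum_Sn.
    set (s := sum_n _ n). intros H1 H2.
    replace (u (S n)) with ((s + u (S n)) + - s)%C by ring.
    eapply Rle_trans; [apply Cmod_triangle|]. rewrite Cmod_opp.
    apply Rplus_le_compat; assumption.
Qed.

Lemma RtoC_disk (t : R) : (0 <= t < 1)%R -> disk t.
Proof. intros H. unfold disk. rewrite Cmod_R, Rabs_pos_eq; lra. Qed.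

(** For small real [t] the tail of the series is [O(t)], because the terms at
    [z = 1/2] are bounded.  The point [z = 0] is excluded so that the statement
    is inherited by the shifted sequence, which is obtained on dividing by [z]. *)
Lemma zero_series_head c :
  (forall z, disk z -> z <> 0 -> sums (fun n => c n * z ^ n) 0) -> c O = 0.
Proof.
  intros H.
  destruct (sums_bounded (fun n => c n * (RtoC (1/2)) ^ n) 0) as [M HM].
  { apply H; [apply RtoC_disk; lra|].
    intros E. apply RtoC_inj in E. lra. }
  assert (Hc : forall t, (0 < t <= 1/4)%R -> (Cmod (c O) <= 4 * M * t)%R).
  { intros t Ht.
    assert (Hs : sums (fun n => c n * (RtoC t) ^ n) 0).
    { apply H; [apply RtoC_disk; lra|]. intros E. apply RtoC_inj in E. lra. }
    apply sums_tail in Hs.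
    assert (Hg : is_series (fun n => M * (2*t) * (2 * t)^n)%R (M * (2*t) * / (1 - 2*t))%R).
    { apply (is_series_scal_l (K := R_AbsRing) (V := R_NormedModule)).
      apply is_series_geom. rewrite Rabs_pos_eq; lra. }
    assert (M0 : (0 <= M)%R) by (eapply Rle_trans; [apply Cmod_ge_0|apply (HM O)]).
    assert (Hle := sums_Cmod_le _ _ _ _ Hs Hg).
    replace (0 - c O * (RtoC t) ^ 0)%C with (- c O)%C in Hle by (simpl; ring).
    rewrite Cmod_opp in Hle.
    eapply Rle_trans; [apply Hle|].
    - intros n.
      replace (c (S n) * (RtoC t)^(S n))%C
         with (c (S n) * (RtoC (1/2))^(S n) * (RtoC (2 * t))^(S n))%C.
      2:{ rewrite <- Cmult_assoc, <- Cpow_mult_l. do 2 f_equal.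
          rewrite <- RtoC_mult. f_equal. field. }
      rewrite Cmod_mult, Cmod_pow, Cmod_R, (Rabs_pos_eq (2*t)) by lra.
      rewrite Rmult_assoc. change (2 * t * (2 * t)^n)%R with ((2*t)^(S n))%R.
      apply Rmult_le_compat_r; [apply pow_le; lra|apply HM].
    - apply (Rmult_le_reg_r (1 - 2*t)); [lra|].
      rewrite (Rmult_assoc (M * (2*t))), Rinv_l by lra.
      assert (0 <= M * t * (1/4 - t))%R by (apply Rmult_le_pos; [apply Rmult_le_pos|]; lra). lra. }
  apply Cmod_eq_0. apply Rle_antisym; [|apply Cmod_ge_0].
  apply le_epsilon. intros eps Heps.
  assert (M0 : (0 <= M)%R) by (eapply Rle_trans; [apply Cmod_ge_0|apply (HM O)]).
  (* Chosen so that [4 * M * t <= eps]; the [+ 1] covers [M = 0]. *)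
  set (t := Rmin (1/4) (eps / (4 * M + 1))).
  assert (He : (0 < eps / (4*M+1))%R) by (apply Rdiv_lt_0_compat; lra).
  assert (Ht : (0 < t <= 1/4)%R).
  { split; [apply Rmin_glb_lt; lra|apply Rmin_l]. }
  specialize (Hc t Ht).
  assert (t <= eps / (4*M+1))%R by apply Rmin_r.
  assert (eps = eps / (4*M+1) * (4*M+1))%R by (field; lra).
  nra.
Qed.

Lemma zero_series_coef c :
  (forall z, disk z -> z <> 0 -> sums (fun n => c n * z ^ n) 0) -> forall n, c n = 0.
Proof.
  intros H n. revert c H. induction n as [|n IH]; intros c H.
  - now apply zero_series_head.
  - apply (IH (fun k => c (S k))). intros z Hz Hz0.
    assert (Hs := sums_scal (/ z) _ _ (sums_tail _ _ (H z Hz Hz0))).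
    cbv beta in Hs. rewrite (zero_series_head c H) in Hs.
    replace (/ z * (0 - 0 * z ^ 0))%C with (RtoC 0) in Hs by ring.
    revert Hs. apply sums_ext. intros k. simpl. field. exact Hz0.
Qed.

Lemma power_series_unique f a b :
  has_power_series f a -> has_power_series f b -> a = b.
Proof.
  intros Ha Hb. apply functional_extensionality. intros n.
  assert (E : (a n + (-1) * b n)%C = 0).
  { apply (zero_series_coef (fun n => a n + (-1) * b n)). intros z Hz _.
    generalize (Ha z Hz) (Hb z Hz). rewrite !is_pseries_sums. intros Sa Sb.
    generalize (sums_plus _ _ _ _ Sa (sums_scal (-1) _ _ Sb)).
    replace (f z + (-1) * f z)%C with (RtoC 0) by ring.
    apply sums_ext. intros k. ring. }
  replace (a n) with ((a n + (-1) * b n) + b n)%C by ring. rewrite E. ring.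
Qed.

Lemma Cconj_RtoC (x : R) : Cconj (RtoC x) = RtoC x.
Proof. unfold Cconj, RtoC. simpl. now rewrite Ropp_0. Qed.

(** * Series of nonnegative terms *)

Lemma ex_series_le_pos (u v : nat -> R) :
  (forall n, 0 <= u n <= v n)%R -> ex_series v -> ex_series u.
Proof.
  intros H Hv. apply (ex_series_le (V := R_CompleteNormedModule) u v); [|exact Hv].
  intros n. change (Rabs (u n) <= v n)%R.
  destruct (H n) as [H1 H2]. now rewrite Rabs_pos_eq.
Qed.

Lemma ex_series_scale (k : R) (u : nat -> R) :
  ex_series u -> ex_series (fun n => k * u n)%R.
Proof. apply (ex_series_scal (K := R_AbsRing) (V := R_NormedModule)). Qed.

Lemma ex_series_add (u v : nat -> R) :
  ex_series u -> ex_series v -> ex_series (fun n => u n + v n)%R.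
Proof. apply (ex_series_plus (K := R_AbsRing) (V := R_NormedModule)). Qed.

Lemma sum_n_incr (u : nat -> R) n : (forall k, 0 <= u k)%R -> (sum_n u n <= sum_n u (S n))%R.
Proof. intros H. rewrite sum_Sn. generalize (H (S n)). unfold plus; simpl. lra. Qed.

Lemma sum_n_le_Series (u : nat -> R) N :
  (forall n, 0 <= u n)%R -> ex_series u -> (sum_n u N <= Series u)%R.
Proof.
  intros H Hu. apply (is_lim_seq_incr_compare (sum_n u)).
  - exact (Series_correct u Hu).
  - intros n. now apply sum_n_incr.
Qed.

Lemma term_le_sum_n (u : nat -> R) N : (forall n, 0 <= u n)%R -> (u N <= sum_n u N)%R.
Proof.
  intros H. destruct N as [|N]; [rewrite sum_O; lra|]. rewrite sum_Sn.
  assert (0 <= sum_n u N)%R.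
  { induction N as [|N IH]; [rewrite sum_O; apply H|].
    eapply Rle_trans; [exact IH|]. now apply sum_n_incr. }
  unfold plus; simpl. lra.
Qed.

Lemma Series_le_bound (u : nat -> R) M :
  (forall n, 0 <= u n)%R -> (forall N, sum_n u N <= M)%R ->
  ex_series u /\ (Series u <= M)%R.
Proof.
  intros H HM.
  destruct (ex_finite_lim_seq_incr (sum_n u) M) as [l Hl].
  - intros n. now apply sum_n_incr.
  - exact HM.
  - split; [now exists l|].
    rewrite (is_series_unique u l Hl).
    exact (is_lim_seq_le (sum_n u) (fun _ => M) l M HM Hl (is_lim_seq_const M)).
Qed.

Lemma Series_pos (u : nat -> R) : (forall n, 0 <= u n)%R -> ex_series u -> (0 <= Series u)%R.
Proof.
  intros H Hu. eapply Rle_trans; [apply (H O)|].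
  eapply Rle_trans; [apply (term_le_sum_n u O H)|]. now apply sum_n_le_Series.
Qed.

(** * The space of square-summable power series *)

Definition l2 (a : nat -> C) : Prop := ex_series (fun n => (Cmod (a n) ^ 2)%R).

Definition H2_coef (f : C -> C) (a : nat -> C) : Prop := has_power_series f a /\ l2 a.

Definition nsq (f : C -> C) : R := Re (inner f f).

Lemma Cmod2_pos (z : C) : (0 <= Cmod z ^ 2)%R.
Proof. apply pow2_ge_0. Qed.

Lemma disk_Cmod2 z : disk z -> (0 <= Cmod z ^ 2 < 1)%R.
Proof.
  intros H. unfold disk in H. generalize (Cmod_ge_0 z). intros H0. split; [apply Cmod2_pos|]. nra.
Qed.

Lemma H2_coef_H2 f a : H2_coef f a -> H2 f.
Proof. intros H. now exists a. Qed.

Lemma taylor_unique f a : has_power_series f a -> taylor f = a.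
Proof.
  intros H. apply (power_series_unique f); [|exact H].
  unfold taylor. apply epsilon_spec. now exists a.
Qed.

Lemma H2_taylor f : H2 f -> H2_coef f (taylor f).
Proof. intros [a [Ha Hl]]. rewrite (taylor_unique f a Ha). now split. Qed.

Lemma H2_coef_ext f g a : f =D g -> H2_coef f a -> H2_coef g a.
Proof.
  intros E [Ha Hl]. split; [|exact Hl]. intros z Hz. rewrite <- (E z Hz). now apply Ha.
Qed.

Lemma taylor_ext f g : H2 f -> f =D g -> taylor g = taylor f.
Proof.
  intros Hf E. apply taylor_unique. apply (H2_coef_ext f g _ E). now apply H2_taylor.
Qed.

Lemma H2_ext f g : f =D g -> H2 f -> H2 g.
Proof. intros E [a Ha]. exists a. now apply (H2_coef_ext f g). Qed.

Lemma eq_on_disk_sym f g : f =D g -> g =D f.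
Proof. intros E z Hz. symmetry. now apply E. Qed.

Lemma inner_ext f f' g g' :
  H2 f -> H2 g -> f =D f' -> g =D g' -> inner f' g' = inner f g.
Proof. intros Hf Hg E E'. unfold inner. now rewrite (taylor_ext f f'), (taylor_ext g g'). Qed.

Lemma nsq_ext f g : H2 f -> f =D g -> nsq g = nsq f.
Proof. intros Hf E. unfold nsq. now rewrite (inner_ext f g f g). Qed.

Lemma Cmod_mult_le (x y : C) : (Cmod (x * y) <= Cmod x ^ 2 + Cmod y ^ 2)%R.
Proof.
  rewrite Cmod_mult. generalize (Cmod_ge_0 x) (Cmod_ge_0 y) (pow2_ge_0 (Cmod x - Cmod y)). nra.
Qed.

Lemma Cmod2_plus_le (x y : C) : (Cmod (x + y) ^ 2 <= 2 * Cmod x ^ 2 + 2 * Cmod y ^ 2)%R.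
Proof.
  apply (Rle_trans _ ((Cmod x + Cmod y) ^ 2)).
  - apply pow_incr. split; [apply Cmod_ge_0|apply Cmod_triangle].
  - generalize (pow2_ge_0 (Cmod x - Cmod y)). lra.
Qed.

Lemma l2_lin c a b : l2 a -> l2 b -> l2 (fun n => c * a n + b n).
Proof.
  intros Ha Hb.
  apply (ex_series_le_pos _ (fun n => 2 * Cmod c ^ 2 * Cmod (a n) ^ 2 + 2 * Cmod (b n) ^ 2)%R).
  - intros n. split; [apply Cmod2_pos|].
    eapply Rle_trans; [apply Cmod2_plus_le|]. rewrite Cmod_mult. right. ring.
  - apply ex_series_add; now apply ex_series_scale.
Qed.

Lemma sums_eval a z : l2 a -> disk z -> sums (fun n => a n * z ^ n) (CSeries (fun n => a n * z ^ n)).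
Proof.
  intros Ha Hz. apply sums_abs.
  apply (ex_series_le_pos _ (fun n => Cmod (a n) ^ 2 + (Cmod z ^ 2) ^ n)%R).
  - intros n. split; [apply Cmod_ge_0|].
    eapply Rle_trans; [apply Cmod_mult_le|]. rewrite Cmod_pow, <- !pow_mult, (Nat.mul_comm n).
    apply Rle_refl.
  - apply ex_series_add; [exact Ha|]. apply ex_series_geom.
    generalize (disk_Cmod2 z Hz). intros ?. rewrite Rabs_pos_eq; lra.
Qed.

Lemma H2_coef_of a : l2 a -> H2_coef (fun z => CSeries (fun n => a n * z ^ n)) a.
Proof.
  intros Ha. split; [|exact Ha]. intros z Hz. apply is_pseries_sums. now apply sums_eval.
Qed.

Lemma H2_coef_lin c f g a b :
  H2_coef f a -> H2_coef g b -> H2_coef (fun z => c * f z + g z) (fun n => c * a n + b n).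
Proof.
  intros [Ha La] [Hb Lb]. split; [|now apply l2_lin].
  intros z Hz. generalize (Ha z Hz) (Hb z Hz). rewrite !is_pseries_sums. intros Sa Sb.
  generalize (sums_plus _ _ _ _ (sums_scal c _ _ Sa) Sb). apply sums_ext. intros n. ring.
Qed.

Lemma H2_lin c f g : H2 f -> H2 g -> H2 (fun z => c * f z + g z).
Proof. intros [a Ha] [b Hb]. eexists. eapply H2_coef_lin; eassumption. Qed.

Lemma taylor_lin c f g : H2 f -> H2 g ->
  taylor (fun z => c * f z + g z) = (fun n => c * taylor f n + taylor g n).
Proof.
  intros Hf Hg. apply taylor_unique. apply H2_coef_lin; now apply H2_taylor.
Qed.

(** [CSeries] takes real and imaginary parts and has no convergence built in;
    absolute convergence makes [inner] a genuine sum, to which linearity and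
    uniqueness of sums apply. *)
Lemma inner_sums f g : H2 f -> H2 g ->
  sums (fun n => taylor f n * Cconj (taylor g n)) (inner f g).
Proof.
  intros Hf Hg. apply sums_abs.
  apply (ex_series_le_pos _ (fun n => Cmod (taylor f n) ^ 2 + Cmod (taylor g n) ^ 2)%R).
  - intros n. split; [apply Cmod_ge_0|].
    eapply Rle_trans; [apply Cmod_mult_le|]. rewrite Cmod_conj. apply Rle_refl.
  - apply ex_series_add; now apply H2_taylor.
Qed.

Lemma inner_lin_l c f g h : H2 f -> H2 g -> H2 h ->
  inner (fun z => c * f z + g z) h = c * inner f h + inner g h.
Proof.
  intros Hf Hg Hh. apply (sums_unique (fun n => taylor (fun z => c * f z + g z) n * Cconj (taylor h n))).
  - apply inner_sums; [now apply H2_lin|exact Hh].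
  - rewrite taylor_lin by assumption.
    generalize (sums_plus _ _ _ _ (sums_scal c _ _ (inner_sums f h Hf Hh)) (inner_sums g h Hg Hh)).
    apply sums_ext. intros n. ring.
Qed.

Lemma inner_conj f g : H2 f -> H2 g -> inner g f = Cconj (inner f g).
Proof.
  intros Hf Hg. apply (sums_unique _ _ _ (inner_sums g f Hg Hf)).
  generalize (sums_conj _ _ (inner_sums f g Hf Hg)). apply sums_ext. intros n.
  rewrite Cmult_conj, Cconj_conj. ring.
Qed.

Lemma inner_lin_r c f g h : H2 f -> H2 g -> H2 h ->
  inner h (fun z => c * f z + g z) = Cconj c * inner h f + inner h g.
Proof.
  intros Hf Hg Hh.
  rewrite (inner_conj (fun z => c * f z + g z) h), inner_lin_l; try assumption; [|now apply H2_lin].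
  rewrite Cplus_conj, Cmult_conj, <- !inner_conj by assumption. reflexivity.
Qed.

Lemma is_series_zero : is_series (fun _ => 0)%R 0%R.
Proof.
  apply (is_lim_seq_ext (fun _ => 0%R) _ (Finite 0)).
  - intros n. rewrite sum_n_const. ring.
  - apply is_lim_seq_const.
Qed.

Lemma H2_zero : H2 (fun _ => 0).
Proof.
  exists (fun _ => 0). split.
  - intros z _. apply is_pseries_sums. apply (sums_ext (fun _ => 0)); [intros; ring|].
    apply sums_pair; apply is_series_zero.
  - exists 0%R. apply (is_series_ext (fun _ => 0%R)); [|apply is_series_zero].
    intros n. rewrite Cmod_0. simpl. ring.
Qed.

Lemma H2_scal c f : H2 f -> H2 (fun z => c * f z).
Proof.
  intros Hf. apply (H2_ext (fun z => c * f z + (fun _ => 0) z)).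
  - intros z _. ring.
  - now apply H2_lin; [|apply H2_zero].
Qed.

Lemma nsq_series f : H2 f -> is_series (fun n => Cmod (taylor f n) ^ 2)%R (nsq f).
Proof.
  intros Hf. generalize (sums_Re _ _ (inner_sums f f Hf Hf)). apply is_series_ext.
  intros n. rewrite <- Cmod2_conj. reflexivity.
Qed.

Lemma nsq_pos f : H2 f -> (0 <= nsq f)%R.
Proof.
  intros Hf. rewrite <- (is_series_unique _ _ (nsq_series f Hf)). apply Series_pos.
  - intros n. apply Cmod2_pos.
  - exists (nsq f). now apply nsq_series.
Qed.

Lemma inner_self f : H2 f -> inner f f = RtoC (nsq f).
Proof.
  intros Hf. assert (H := inner_conj f f Hf Hf). unfold nsq.
  destruct (inner f f) as [x y]. apply (f_equal Im) in H. simpl in *.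
  unfold RtoC. f_equal. lra.
Qed.

Lemma normH2_nsq f : normH2 f = sqrt (nsq f).
Proof. reflexivity. Qed.

Lemma nsq_lin c f g : H2 f -> H2 g ->
  nsq (fun z => c * f z + g z)
  = (Cmod c ^ 2 * nsq f + 2 * Re (c * inner f g) + nsq g)%R.
Proof.
  intros Hf Hg. unfold nsq at 1.
  rewrite inner_lin_l, !inner_lin_r, !inner_self, (inner_conj f g) by (try assumption; now apply H2_lin).
  destruct (inner f g) as [x y]. destruct c as [u v]. rewrite Cmod2_alt. simpl. ring.
Qed.

Lemma inner_scal_l c f g : H2 f -> H2 g -> inner (fun z => c * f z) g = c * inner f g.
Proof.
  intros Hf Hg.
  rewrite (inner_ext (fun z => (c - 1) * f z + f z) (fun z => c * f z) g g); try easy.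
  - rewrite inner_lin_l by assumption. ring.
  - now apply H2_lin.
  - intros z _. ring.
Qed.

Lemma inner_scal_r c f g : H2 f -> H2 g -> inner f (fun z => c * g z) = Cconj c * inner f g.
Proof.
  intros Hf Hg. rewrite (inner_conj (fun z => c * g z)), inner_scal_l, Cmult_conj, <- inner_conj
    by (try assumption; now apply H2_scal).
  reflexivity.
Qed.

Lemma nsq_scal c f : H2 f -> nsq (fun z => c * f z) = (Cmod c ^ 2 * nsq f)%R.
Proof.
  intros Hf. unfold nsq at 1.
  rewrite inner_scal_l, inner_scal_r, inner_self by (try assumption; now apply H2_scal).
  rewrite Cmult_assoc, <- Cmod2_conj, <- RtoC_mult. reflexivity.
Qed.

(** The squared norm of [g - x * Cconj (inner f g) * f] is a nonnegative
    quadratic polynomial in the real parameter [x]. *)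
Lemma cauchy_schwarz f g : H2 f -> H2 g -> (Cmod (inner f g) ^ 2 <= nsq f * nsq g)%R.
Proof.
  intros Hf Hg. set (P := (Cmod (inner f g) ^ 2)%R).
  assert (P0 : (0 <= P)%R) by apply Cmod2_pos.
  assert (F0 := nsq_pos f Hf). assert (G0 := nsq_pos g Hg).
  assert (Q : forall x : R, (0 <= x ^ 2 * P * nsq f - 2 * x * P + nsq g)%R).
  { intros x. assert (N := nsq_pos _ (H2_lin (- RtoC x * Cconj (inner f g)) f g Hf Hg)).
    rewrite nsq_lin in N by assumption.
    rewrite Cmod_mult, Cmod_opp, Cmod_conj, Cmod_R, Rpow_mult_distr, <- Rsqr_pow2, <- Rsqr_abs in N.
    fold P in N.
    replace (- x * Cconj (inner f g) * inner f g) with (- RtoC x * (inner f g * Cconj (inner f g))) in N by ring.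
    rewrite <- Cmod2_conj in N. fold P in N. rewrite Rsqr_pow2 in N.
    replace (Re (- RtoC x * RtoC P)) with (- (x * P))%R in N.
    - lra.
    - rewrite <- RtoC_opp, <- RtoC_mult. simpl. ring. }
  destruct (Req_dec (nsq f) 0) as [E|E].
  - rewrite E in Q |- *. destruct (Req_dec P 0) as [EP|EP]; [rewrite EP; lra|].
    specialize (Q ((nsq g + 1) / (2 * P))%R).
    replace (2 * ((nsq g + 1) / (2 * P)) * P)%R with (nsq g + 1)%R in Q by (field; exact EP). lra.
  - specialize (Q (/ nsq f)%R).
    replace ((/ nsq f) ^ 2 * P * nsq f - 2 * / nsq f * P + nsq g)%R
      with ((nsq f * nsq g - P) / nsq f)%R in Q by (field; exact E).
    assert (0 <= (nsq f * nsq g - P) / nsq f * nsq f)%R by (apply Rmult_le_pos; assumption).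
    replace ((nsq f * nsq g - P) / nsq f * nsq f)%R with (nsq f * nsq g - P)%R in H by (field; exact E).
    lra.
Qed.

(** * Kernels, shift and division *)

Definition szego (w : C) : C -> C := fun z => / (1 - Cconj w * z).

Lemma Cmod_mult_lt_1 x y : (Cmod x <= 1)%R -> (Cmod y < 1)%R -> (Cmod (x * y) < 1)%R.
Proof. intros Hx Hy. rewrite Cmod_mult. generalize (Cmod_ge_0 x) (Cmod_ge_0 y). nra. Qed.

Lemma one_minus_neq_0 x : (Cmod x < 1)%R -> 1 - x <> 0.
Proof.
  intros H E. replace x with (1 - (1 - x)) in H by ring. rewrite E in H.
  replace (1 - 0) with (RtoC 1) in H by ring. rewrite Cmod_1 in H. lra.
Qed.

Lemma disk_conj z : disk z -> disk (Cconj z).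
Proof. unfold disk. now rewrite Cmod_conj. Qed.

Lemma szego_denom w z : disk w -> disk z -> 1 - Cconj w * z <> 0.
Proof.
  intros Hw Hz. apply one_minus_neq_0. apply Cmod_mult_lt_1; [|exact Hz].
  rewrite Cmod_conj. now apply Rlt_le.
Qed.

Lemma l2_pow x : (Cmod x < 1)%R -> l2 (fun n => x ^ n).
Proof.
  intros Hx. apply (ex_series_ext (fun n => (Cmod x ^ 2) ^ n)%R).
  - intros n. rewrite Cmod_pow, <- !pow_mult. f_equal. lia.
  - apply ex_series_geom. generalize (disk_Cmod2 x Hx). intros ?. rewrite Rabs_pos_eq; lra.
Qed.

Lemma sums_geom x : (Cmod x < 1)%R -> sums (fun n => x ^ n) (/ (1 - x)).
Proof.
  intros Hx.
  assert (H : sums (fun n => x ^ n) (CSeries (fun n => x ^ n))).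
  { apply sums_abs. apply (ex_series_ext (fun n => Cmod x ^ n)%R).
    - intros n. now rewrite Cmod_pow.
    - apply ex_series_geom. now rewrite Rabs_pos_eq by apply Cmod_ge_0. }
  set (l := CSeries _) in H.
  assert (E : l - 1 = x * l).
  { apply (sums_unique _ _ _ (sums_tail _ _ H)).
    generalize (sums_scal x _ _ H). apply sums_ext. intros n. reflexivity. }
  replace (/ (1 - x)) with l; [exact H|].
  assert (N := one_minus_neq_0 x Hx).
  replace l with ((1 - x) * l * / (1 - x)) by (field; exact N).
  replace ((1 - x) * l) with (l - x * l) by ring. rewrite <- E. field. exact N.
Qed.

Lemma H2_coef_szego w : disk w -> H2_coef (szego w) (fun n => Cconj w ^ n).
Proof.
  intros Hw. split; [|apply l2_pow; now rewrite Cmod_conj].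
  intros z Hz. apply is_pseries_sums. unfold szego.
  apply (sums_ext (fun n => (Cconj w * z) ^ n)).
  - intros n. apply Cpow_mult_l.
  - apply sums_geom. apply Cmod_mult_lt_1; [|exact Hz]. rewrite Cmod_conj. now apply Rlt_le.
Qed.

Lemma H2_szego w : disk w -> H2 (szego w).
Proof. intros Hw. eapply H2_coef_H2. now apply H2_coef_szego. Qed.

Lemma inner_szego f w : H2 f -> disk w -> inner f (szego w) = f w.
Proof.
  intros Hf Hw. apply (sums_unique _ _ _ (inner_sums f _ Hf (H2_szego w Hw))).
  rewrite (taylor_unique _ _ (proj1 (H2_coef_szego w Hw))).
  generalize (proj1 (H2_taylor f Hf) w Hw). rewrite is_pseries_sums.
  apply sums_ext. intros n. now rewrite Cpow_conj, Cconj_conj.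
Qed.

Lemma nsq_szego w : disk w -> nsq (szego w) = (/ (1 - Cmod w ^ 2))%R.
Proof.
  intros Hw. unfold nsq. rewrite inner_szego by (try assumption; now apply H2_szego).
  unfold szego. rewrite Cmult_comm, <- Cmod2_conj, <- RtoC_minus, <- RtoC_inv; [reflexivity|].
  generalize (disk_Cmod2 w Hw). lra.
Qed.

Lemma H2_eval_bound f w : H2 f -> disk w ->
  (Cmod (f w) ^ 2 <= nsq f * / (1 - Cmod w ^ 2))%R.
Proof.
  intros Hf Hw. rewrite <- nsq_szego, <- (inner_szego f w) by assumption.
  apply cauchy_schwarz; [assumption|now apply H2_szego].
Qed.

Lemma disk_0 : disk 0.
Proof. unfold disk. rewrite Cmod_0. lra. Qed.

Lemma szego_0 z : szego 0 z = 1.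
Proof. unfold szego. rewrite Cconj_RtoC. replace (1 - 0 * z) with (RtoC 1) by ring. field.
Qed.

Lemma H2_const c : H2 (fun _ => c).
Proof.
  apply (H2_ext (fun z => c * szego 0 z)).
  - intros z _. rewrite szego_0. ring.
  - apply H2_scal, H2_szego, disk_0.
Qed.

Definition shift_coef (a : nat -> C) (n : nat) : C := match n with O => 0 | S m => a m end.

Lemma H2_coef_shift f a : H2_coef f a -> H2_coef (fun z => z * f z) (shift_coef a).
Proof.
  intros [Ha La]. split.
  - intros z Hz. generalize (Ha z Hz). rewrite !is_pseries_sums. intros H.
    replace (z * f z) with (shift_coef a O * z ^ O + z * f z) by (simpl; ring).
    apply (sums_cons (fun n => shift_coef a n * z ^ n)).
    generalize (sums_scal z _ _ H). apply sums_ext. intros n. simpl. ring.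
  - apply (ex_series_incr_1 (K := R_AbsRing) (V := R_NormedModule)). exact La.
Qed.

Lemma H2_shift f : H2 f -> H2 (fun z => z * f z).
Proof. intros [a Ha]. eexists. apply H2_coef_shift. exact Ha. Qed.

(** The shift is an isometry: this stands in for [|z| = 1] on the circle, and
    reduces comparisons on the circle to algebra in the Hilbert space. *)
Lemma inner_shift f g : H2 f -> H2 g -> inner (fun z => z * f z) (fun z => z * g z) = inner f g.
Proof.
  intros Hf Hg. apply (sums_unique _ _ _ (inner_sums _ _ (H2_shift f Hf) (H2_shift g Hg))).
  rewrite (taylor_unique _ _ (proj1 (H2_coef_shift f _ (H2_taylor f Hf)))).
  rewrite (taylor_unique _ _ (proj1 (H2_coef_shift g _ (H2_taylor g Hg)))).
  replace (inner f g) with (shift_coef (taylor f) O * Cconj (shift_coef (taylor g) O) + inner f g)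
    by (simpl; ring).
  apply (sums_cons (fun n => shift_coef (taylor f) n * Cconj (shift_coef (taylor g) n))).
  now apply inner_sums.
Qed.

(** The coefficients of [h / (1 - q z)]: the recursion is [(1 - q z) g = h]. *)
Fixpoint div_coef (q : C) (h : nat -> C) (n : nat) : C :=
  match n with O => h O | S m => q * div_coef q h m + h (S m) end.

(** Convexity gives [|q g + h|^2 <= |q| |g|^2 + |h|^2 / (1 - |q|)] for
    consecutive coefficients.  The extra term in [|q|] on the left is the part of
    the last coefficient that the next step consumes. *)
Lemma div_coef_bound q h N : (Cmod q < 1)%R ->
  ((1 - Cmod q) * sum_n (fun n => Cmod (div_coef q h n) ^ 2) N
     + Cmod q * Cmod (div_coef q h N) ^ 2
   <= sum_n (fun n => Cmod (h n) ^ 2) N / (1 - Cmod q))%R.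
Proof.
  intros Hq. assert (Q0 := Cmod_ge_0 q). set (r := Cmod q) in *.
  assert (I0 : (1 <= / (1 - r))%R).
  { rewrite <- Rinv_1 at 1. apply Rinv_le_contravar; lra. }
  induction N as [|N IH].
  - rewrite !sum_O. simpl div_coef. generalize (Cmod2_pos (h O)). intros H.
    unfold Rdiv. nra.
  - rewrite !sum_Sn. change (@plus R_AbelianMonoid) with Rplus.
    set (S1 := sum_n (fun n => Cmod (div_coef q h n) ^ 2)%R N) in *.
    set (T1 := sum_n (fun n => Cmod (h n) ^ 2)%R N) in *.
    set (G := Cmod (div_coef q h N)) in *. set (H := Cmod (h (S N))).
    assert (B : (Cmod (div_coef q h (S N)) ^ 2 <= r * G ^ 2 + H ^ 2 / (1 - r))%R).
    { apply (Rle_trans _ ((r * G + H) ^ 2)).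
      - apply pow_incr. split; [apply Cmod_ge_0|]. simpl div_coef.
        eapply Rle_trans; [apply Cmod_triangle|]. rewrite Cmod_mult. apply Rle_refl.
      - assert (0 <= r * (1 - r) * (G - H / (1 - r)) ^ 2)%R.
        { apply Rmult_le_pos; [nra|apply pow2_ge_0]. }
        replace (r * (1 - r) * (G - H / (1 - r)) ^ 2)%R
          with (r * G ^ 2 + H ^ 2 / (1 - r) - (r * G + H) ^ 2)%R in H0 by (field; lra). lra. }
    fold H. unfold Rdiv in *. lra.
Qed.

Lemma H2_div q h : (Cmod q < 1)%R -> H2 h ->
  H2 (fun z => h z / (1 - q * z)) /\
  (nsq (fun z => (h z / (1 - q * z))%C) <= / (1 - Cmod q) ^ 2 * nsq h)%R.
Proof.
  intros Hq Hh. assert (Q0 := Cmod_ge_0 q). set (a := taylor h).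
  assert (L : l2 (div_coef q a) /\
    (Series (fun n => Cmod (div_coef q a n) ^ 2) <= / (1 - Cmod q) ^ 2 * nsq h)%R).
  { apply Series_le_bound; [intros n; apply Cmod2_pos|]. intros N.
    assert (B := div_coef_bound q a N Hq).
    assert (T : (sum_n (fun n => Cmod (a n) ^ 2) N <= nsq h)%R).
    { rewrite <- (is_series_unique _ _ (nsq_series h Hh)).
      apply sum_n_le_Series; [intros n; apply Cmod2_pos|]. exists (nsq h). now apply nsq_series. }
    set (S1 := sum_n _ N) in B |- *. set (T1 := sum_n _ N) in B, T.
    assert (P := Cmod2_pos (div_coef q a N)).
    replace (/ (1 - Cmod q) ^ 2 * nsq h)%R with (nsq h / (1 - Cmod q) / (1 - Cmod q))%R by (field; lra).
    apply (Rmult_le_reg_r (1 - Cmod q)); [lra|].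
    unfold Rdiv at 1. rewrite (Rmult_assoc (nsq h / _)), Rinv_l, Rmult_1_r by lra.
    assert (T1 / (1 - Cmod q) <= nsq h / (1 - Cmod q))%R.
    { apply Rmult_le_compat_r; [left; apply Rinv_0_lt_compat; lra|exact T]. }
    assert (0 <= Cmod q * Cmod (div_coef q a N) ^ 2)%R by now apply Rmult_le_pos.
    lra. }
  assert (HC : H2_coef (fun z => h z / (1 - q * z)) (div_coef q a)).
  { apply (H2_coef_ext (fun z => CSeries (fun n => div_coef q a n * z ^ n))); [|now apply H2_coef_of].
    intros z Hz. set (G := CSeries _).
    assert (HG : sums (fun n => div_coef q a n * z ^ n) G) by now apply sums_eval.
    assert (Ha := proj1 (H2_taylor h Hh) z Hz). rewrite is_pseries_sums in Ha.
    assert (N : 1 - q * z <> 0).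
    { apply one_minus_neq_0, Cmod_mult_lt_1; [lra|exact Hz]. }
    assert (E : G - a O = q * z * G + (h z - a O)).
    { apply (sums_unique (fun n => div_coef q a (S n) * z ^ (S n))).
      - replace (G - a O) with (G - div_coef q a O * z ^ O) by (simpl; ring).
        apply (sums_tail (fun n => div_coef q a n * z ^ n)). exact HG.
      - replace (h z - a O) with (h z - taylor h O * z ^ O) by (unfold a; simpl; ring).
        generalize (sums_plus _ _ _ _ (sums_scal (q * z) _ _ HG) (sums_tail _ _ Ha)).
        apply sums_ext. intros n. unfold a. simpl. ring. }
    replace (h z) with ((1 - q * z) * G); [field; exact N|].
    replace ((1 - q * z) * G) with ((G - a O) - q * z * G + a O) by ring. rewrite E. ring. }
  split; [now exists (div_coef q a)|].
  rewrite <- (is_series_unique _ _ (nsq_series _ (H2_coef_H2 _ _ HC))).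
  rewrite (taylor_unique _ _ (proj1 HC)). apply L.
Qed.

(** * The conjugation J *)

Lemma J_spec f : H2 f ->
  H2_coef (J f) (fun n => Cconj (taylor f n)) /\
  (forall z, disk z -> J f z = Cconj (f (Cconj z))) /\ nsq (J f) = nsq f.
Proof.
  intros Hf. destruct (H2_taylor f Hf) as [Ha La].
  assert (Lc : l2 (fun n => Cconj (taylor f n))).
  { revert La. apply ex_series_ext. intros n. now rewrite Cmod_conj. }
  assert (HJ : H2_coef (J f) (fun n => Cconj (taylor f n))) by exact (H2_coef_of _ Lc).
  split; [exact HJ|split].
  - intros z Hz. unfold J. apply sums_CSeries.
    generalize (Ha _ (disk_conj z Hz)). rewrite is_pseries_sums. intros H.
    generalize (sums_conj _ _ H). apply sums_ext. intros n.
    now rewrite Cmult_conj, Cpow_conj, Cconj_conj.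
  - assert (HJ2 := H2_coef_H2 _ _ HJ).
    rewrite <- (is_series_unique _ _ (nsq_series _ HJ2)), (taylor_unique _ _ (proj1 HJ)).
    rewrite <- (is_series_unique _ _ (nsq_series _ Hf)). apply Series_ext.
    intros n. now rewrite Cmod_conj.
Qed.

(** * Completeness *)

Lemma is_lim_seq_sum_n (u : nat -> nat -> R) (l : nat -> R) N :
  (forall k, is_lim_seq (fun n => u n k) (l k)) ->
  is_lim_seq (fun n => sum_n (u n) N) (sum_n l N).
Proof.
  intros H. induction N as [|N IH].
  - apply (is_lim_seq_ext (fun n => u n O)); [intros n; now rewrite sum_O|]. rewrite sum_O. apply H.
  - apply (is_lim_seq_ext (fun n => sum_n (u n) N + u n (S N))%R); [intros n; now rewrite sum_Sn|].
    rewrite sum_Sn. now apply is_lim_seq_plus'.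
Qed.

(** Coefficients converge because the space norm dominates each of them, and
    the estimates on partial sums survive the limit.  The pointwise hypothesis
    identifies the limit, since point evaluations are bounded.  Keeping the
    rate [e] makes the norm bound a byproduct: it is the case [n = 0] when
    [F 0 = 0]. *)
Lemma H2_complete (F : nat -> C -> C) (e : nat -> R) (f : C -> C) :
  (forall n, H2 (F n)) ->
  (forall n m, (n <= m)%nat -> nsq (fun z => ((-1) * F n z + F m z)%C) <= e n)%R ->
  is_lim_seq e 0 ->
  (forall z, disk z -> is_lim_seq (fun n => Cmod (F n z - f z)%C) 0) ->
  H2 f /\ forall n, (nsq (fun z => ((-1) * F n z + f z)%C) <= e n)%R.
Proof.
  intros HF HC He Hlim. set (A := fun n => taylor (F n)).
  assert (D : forall n m N, (n <= m)%nat ->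
            (sum_n (fun k => Cmod ((-1) * A n k + A m k)%C ^ 2) N <= e n)%R).
  { intros n m N Hnm. eapply Rle_trans; [|apply (HC n m Hnm)].
    assert (HD := H2_lin (-1) _ _ (HF n) (HF m)).
    rewrite <- (is_series_unique _ _ (nsq_series _ HD)), taylor_lin by apply HF.
    apply sum_n_le_Series; [intros; apply Cmod2_pos|].
    exact (l2_lin _ _ _ (proj2 (H2_taylor _ (HF n))) (proj2 (H2_taylor _ (HF m)))). }
  assert (D1 : forall n m k, (n <= m)%nat -> (Cmod (A m k - A n k)%C ^ 2 <= e n)%R).
  { intros n m k Hnm. eapply Rle_trans; [|apply (D n m k Hnm)].
    replace (A m k - A n k) with ((-1) * A n k + A m k) by ring.
    apply (term_le_sum_n (fun k => Cmod ((-1) * A n k + A m k)%C ^ 2)%R). intros j. apply Cmod2_pos. }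
  assert (Cauchy : forall (p : C -> R), (forall x y, Rabs (p x - p y) <= Cmod (x - y)%C)%R ->
    forall k, ex_finite_lim_seq (fun n => p (A n k))).
  { intros p Hp k. apply ex_lim_seq_cauchy_corr. intros eps.
    assert (E2 : (0 < (eps / 2) ^ 2)%R) by (apply pow_lt; generalize (cond_pos eps); lra).
    apply is_lim_seq_spec in He. destruct (He (mkposreal _ E2)) as [N HN]. simpl in HN.
    assert (B : forall n, (N <= n)%nat -> (Rabs (p (A n k) - p (A N k)) < eps / 2)%R).
    { intros n Hn. eapply Rle_lt_trans; [apply Hp|].
      assert (D2 := D1 N n k Hn). specialize (HN N (Nat.le_refl N)).
      rewrite Rminus_0_r in HN. apply Rabs_lt_between in HN.
      destruct (Rlt_or_le (Cmod (A n k - A N k)%C) (eps / 2)) as [L|L]; [exact L|exfalso].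
      assert ((eps / 2) ^ 2 <= Cmod (A n k - A N k)%C ^ 2)%R.
      { apply pow_incr. generalize (cond_pos eps). lra. }
      lra. }
    exists N. intros n m Hn Hm.
    replace (p (A n k) - p (A m k))%R with ((p (A n k) - p (A N k)) - (p (A m k) - p (A N k)))%R by ring.
    eapply Rle_lt_trans; [apply Rabs_triang|]. rewrite Rabs_Ropp.
    generalize (B n Hn) (B m Hm). lra. }
  assert (HRe : forall k, ex_finite_lim_seq (fun n => Re (A n k))).
  { apply Cauchy. intros x y. apply (re_le_Cmod (x - y)). }
  assert (HIm : forall k, ex_finite_lim_seq (fun n => Im (A n k))).
  { apply Cauchy. intros x y. eapply Rle_trans; [|apply Rmax_Cmod].
    apply (Rle_trans _ (Rabs (snd (x - y)))); [apply Rle_refl|apply Rmax_r]. }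
  (* The coefficientwise limit, taken on real and imaginary parts. *)
  set (b := fun k => (real (Lim_seq (fun n => Re (A n k))), real (Lim_seq (fun n => Im (A n k)))) : C).
  assert (Lb : forall n N, (sum_n (fun k => Cmod ((-1) * A n k + b k)%C ^ 2) N <= e n)%R).
  { intros n N.
    assert (L : is_lim_seq (fun m => sum_n (fun k => Cmod ((-1) * A n k + A m k)%C ^ 2)%R N)
                  (sum_n (fun k => Cmod ((-1) * A n k + b k)%C ^ 2)%R N)).
    { apply is_lim_seq_sum_n. intros k.
      destruct (HRe k) as [x Hx]. destruct (HIm k) as [y Hy].
      assert (Eb : b k = (x, y)).
      { unfold b. now rewrite (is_lim_seq_unique _ _ Hx), (is_lim_seq_unique _ _ Hy). }
      apply (is_lim_seq_ext (fun m => (- Re (A n k) + Re (A m k)) * (- Re (A n k) + Re (A m k))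
                                  + (- Im (A n k) + Im (A m k)) * (- Im (A n k) + Im (A m k)))%R).
      - intros m. rewrite Cmod2_alt. destruct (A n k), (A m k). simpl. ring.
      - rewrite Cmod2_alt, Eb.
        replace (Re ((-1) * A n k + (x, y))%C ^ 2 + Im ((-1) * A n k + (x, y))%C ^ 2)%R
          with ((- Re (A n k) + x) * (- Re (A n k) + x) + (- Im (A n k) + y) * (- Im (A n k) + y))%R
          by (destruct (A n k); simpl; ring).
        apply is_lim_seq_plus'; apply is_lim_seq_mult'; apply is_lim_seq_plus';
          try assumption; apply is_lim_seq_const. }
    apply (is_lim_seq_le_loc _ (fun _ => e n) _ (e n)
      (ex_intro _ n (fun m Hm => D n m N Hm)) L (is_lim_seq_const _)). }
  assert (Ld : forall n, l2 (fun k => (-1) * A n k + b k) /\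
    (Series (fun k => Cmod ((-1) * A n k + b k)%C ^ 2) <= e n)%R).
  { intros n. apply Series_le_bound; [intros k; apply Cmod2_pos|apply Lb]. }
  assert (Hb : l2 b).
  { generalize (l2_lin 1 _ _ (proj2 (H2_taylor _ (HF O))) (proj1 (Ld O))).
    apply ex_series_ext. intros k. unfold A. do 2 f_equal. ring. }
  set (G := fun z => CSeries (fun n => b n * z ^ n)).
  assert (HG : H2_coef G b) by now apply H2_coef_of.
  assert (HGF : forall n, (nsq (fun z => ((-1) * F n z + G z)%C) <= e n)%R).
  { intros n. assert (HD := H2_coef_lin (-1) _ _ _ _ (H2_taylor _ (HF n)) HG).
    rewrite <- (is_series_unique _ _ (nsq_series _ (H2_coef_H2 _ _ HD))), (taylor_unique _ _ (proj1 HD)).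
    apply Ld. }
  assert (HG2 := H2_coef_H2 _ _ HG).
  assert (E : G =D f).
  { intros z Hz.
    assert (B : forall n, (Cmod (G z - f z)%C ^ 2 <=
        2 * (/ (1 - Cmod z ^ 2) * e n) + 2 * (Cmod (F n z - f z)%C) ^ 2)%R).
    { intros n. replace (G z - f z) with (((-1) * F n z + G z) + (F n z - f z)) by ring.
      eapply Rle_trans; [apply Cmod2_plus_le|]. apply Rplus_le_compat_r, Rmult_le_compat_l; [lra|].
      eapply Rle_trans; [apply (H2_eval_bound (fun z => (-1) * F n z + G z) z); [|exact Hz]|].
      - now apply H2_lin.
      - rewrite Rmult_comm. apply Rmult_le_compat_l; [|apply HGF].
        left. apply Rinv_0_lt_compat. generalize (disk_Cmod2 z Hz). lra. }
    assert (L : is_lim_seq (fun n => 2 * (/ (1 - Cmod z ^ 2) * e n) + 2 * (Cmod (F n z - f z)%C) ^ 2)%R 0).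
    { replace (Finite 0) with (Finite (2 * (/ (1 - Cmod z ^ 2) * 0) + 2 * 0)%R) by (f_equal; ring).
      apply is_lim_seq_plus'; apply is_lim_seq_mult'; try apply is_lim_seq_const.
      - apply is_lim_seq_mult'; [apply is_lim_seq_const|exact He].
      - apply (is_lim_seq_Cmod2 (fun n => F n z - f z)). now apply Hlim. }
    assert (Z := is_lim_seq_le _ _ (Cmod (G z - f z)%C ^ 2)%R 0 B (is_lim_seq_const _) L). simpl Rbar_le in Z.
    assert (Z' : Cmod (G z - f z) = 0%R).
    { generalize (Cmod_ge_0 (G z - f z)). intros. nra. }
    apply Cmod_eq_0 in Z'. replace (G z) with ((G z - f z) + f z) by ring. rewrite Z'. ring. }
  split; [now apply (H2_ext G)|].
  intros n. rewrite (nsq_ext (fun z => (-1) * F n z + G z)); [apply HGF|now apply H2_lin|].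
  intros z Hz. now rewrite (E z Hz).
Qed.

(** * Weighted composition operators fixing a zero *)

(** Horner form: it peels off the constant term, which is the step of
    Littlewood's argument, and [poly a 0 = 0] gives the norm bound in
    [weighted_composition_bound]. *)
Fixpoint poly (a : nat -> C) (N : nat) (z : C) : C :=
  match N with
  | O => 0
  | S N' => a O + z * poly (fun k => a (S k)) N' z
  end.

Fixpoint sqsum (a : nat -> C) (N : nat) : R :=
  match N with
  | O => 0%R
  | S N' => (Cmod (a O) ^ 2 + sqsum (fun k => a (S k)) N')%R
  end.

Lemma sum_n_head {G : AbelianMonoid} (u : nat -> G) N :
  sum_n u (S N) = plus (u O) (sum_n (fun k => u (S k)) N).
Proof. unfold sum_n. rewrite sum_Sn_m by lia. now rewrite sum_n_m_S. Qed.

Lemma poly_sum_n a N z :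
  poly a (S N) z = sum_n (G := C_AbelianMonoid) (fun k => a k * z ^ k) N.
Proof.
  revert a. induction N as [|N IH]; intros a.
  - rewrite sum_O. simpl. ring.
  - rewrite sum_n_head. change (poly a (S (S N)) z) with (a O + z * poly (fun k => a (S k)) (S N) z).
    rewrite IH. change (@plus C_AbelianMonoid) with Cplus. f_equal; [simpl; ring|].
    rewrite <- (sum_n_mult_l (K := C_Ring)). apply sum_n_ext. intros k.
    change (@mult C_Ring) with Cmult. simpl. ring.
Qed.

Lemma poly_snoc a N z : poly a (S N) z = a N * z ^ N + poly a N z.
Proof.
  destruct N as [|N]; [simpl; ring|].
  rewrite (poly_sum_n a (S N)), (poly_sum_n a N), sum_Sn.
  change (@plus C_AbelianMonoid) with Cplus. ring.
Qed.

Lemma sqsum_sum_n a N : sqsum a (S N) = sum_n (fun k => Cmod (a k) ^ 2)%R N.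
Proof.
  revert a. induction N as [|N IH]; intros a.
  - rewrite sum_O. simpl. ring.
  - rewrite sum_n_head. change (@plus R_AbelianMonoid) with Rplus.
    change (sqsum a (S (S N))) with (Cmod (a O) ^ 2 + sqsum (fun k => a (S k)) (S N))%R.
    now rewrite IH.
Qed.

Definition contractive_multiplier (tau : C -> C) : Prop :=
  forall h, H2 h -> H2 (fun z => tau z * h z) /\ (nsq (fun z => (tau z * h z)%C) <= nsq h)%R.

Section Composition.

Variables (tau : C -> C) (b : C).
Hypothesis Hb : disk b.
Hypothesis Htau : forall z, disk z -> disk (tau z).
Hypothesis Hfix : tau b = 0.
Hypothesis Hmul : contractive_multiplier tau.

(** [szego b] is orthogonal to [tau * h], since the inner product is the
    conjugate of [tau b * h b = 0]. *)
Lemma nsq_head_orthogonal c h : H2 h ->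
  H2 (fun z => c * szego b z + tau z * h z) /\
  (nsq (fun z => (c * szego b z + tau z * h z)%C) <= nsq (szego b) * Cmod c ^ 2 + nsq h)%R.
Proof.
  intros Hh. destruct (Hmul h Hh) as [Hth Nth]. assert (Hk := H2_szego b Hb).
  split; [now apply H2_lin|].
  rewrite (nsq_lin c (szego b) (fun z => tau z * h z)) by assumption.
  assert (E : inner (szego b) (fun z => tau z * h z) = 0).
  { rewrite (inner_conj (fun z => tau z * h z)), inner_szego, Hfix by assumption.
    replace (0 * h b) with (RtoC 0) by ring. apply Cconj_RtoC. }
  rewrite E. replace (c * 0) with (RtoC 0) by ring. simpl Re. lra.
Qed.

(** Induction on both lengths.  While [n] is positive the two constant terms
    cancel and multiplication by [tau] contracts; at [n = 0] the constant terms of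
    the longer polynomial contribute orthogonally. *)
Lemma poly_comp_bound a n m : (n <= m)%nat ->
  H2 (fun z => (-1) * (szego b z * poly a n (tau z)) + szego b z * poly a m (tau z)) /\
  (nsq (fun z => ((-1) * (szego b z * poly a n (tau z)) + szego b z * poly a m (tau z))%C)
     <= nsq (szego b) * (sqsum a m - sqsum a n))%R.
Proof.
  revert a m. induction n as [|n IHn]; intros a m Hnm.
  - clear Hnm. revert a. induction m as [|m IHm]; intros a.
    + simpl. replace (fun z => (-1) * (szego b z * 0) + szego b z * 0) with (fun _ : C => 0 * 0).
      2:{ apply functional_extensionality. intros z. ring. }
      split; [apply H2_scal, H2_zero|]. rewrite (nsq_scal 0 (fun _ => 0)) by apply H2_zero.
      rewrite Cmod_0. lra.
    + destruct (IHm (fun k => a (S k))) as [H1 H2'].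
      destruct (nsq_head_orthogonal (a O) _ H1) as [H3 H4].
      assert (E : (fun z => a O * szego b z + tau z * ((-1) * (szego b z * poly (fun k => a (S k)) 0 (tau z))
                      + szego b z * poly (fun k => a (S k)) m (tau z)))
          = (fun z => (-1) * (szego b z * poly a 0 (tau z)) + szego b z * poly a (S m) (tau z))).
      { apply functional_extensionality. intros z. simpl. ring. }
      rewrite E in H3, H4. split; [exact H3|]. eapply Rle_trans; [exact H4|].
      simpl in H2' |- *. simpl. lra.
  - destruct m as [|m]; [lia|].
    destruct (IHn (fun k => a (S k)) m ltac:(lia)) as [H1 H2'].
    destruct (Hmul _ H1) as [H3 H4].
    assert (E : (fun z => tau z * ((-1) * (szego b z * poly (fun k => a (S k)) n (tau z))
                      + szego b z * poly (fun k => a (S k)) m (tau z)))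
        = (fun z => (-1) * (szego b z * poly a (S n) (tau z)) + szego b z * poly a (S m) (tau z))).
    { apply functional_extensionality. intros z. simpl. ring. }
    rewrite E in H3, H4. split; [exact H3|]. eapply Rle_trans; [exact H4|].
    eapply Rle_trans; [exact H2'|]. right. simpl. ring.
Qed.

Lemma poly_comp_H2 a n : H2 (fun z => szego b z * poly a n (tau z)).
Proof.
  destruct (poly_comp_bound a 0 n) as [H _]; [lia|]. revert H. apply H2_ext.
  intros z _. simpl. ring.
Qed.

Lemma sqsum_le_nsq f n : H2 f -> (sqsum (taylor f) n <= nsq f)%R.
Proof.
  intros Hf. destruct n as [|n]; [now apply nsq_pos|].
  rewrite sqsum_sum_n, <- (is_series_unique _ _ (nsq_series f Hf)).
  apply sum_n_le_Series; [intros; apply Cmod2_pos|]. exists (nsq f). now apply nsq_series.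
Qed.

Lemma sqsum_lim f : H2 f -> is_lim_seq (sqsum (taylor f)) (nsq f).
Proof.
  intros Hf. apply is_lim_seq_incr_1.
  apply (is_lim_seq_ext (sum_n (fun k => Cmod (taylor f k) ^ 2)%R)).
  - intros n. now rewrite sqsum_sum_n.
  - exact (nsq_series f Hf).
Qed.

Lemma poly_lim f z : H2 f -> disk z ->
  is_lim_seq (fun n => Cmod (poly (taylor f) n z - f z)) 0.
Proof.
  intros Hf Hz. apply (is_lim_seq_incr_1 (fun n => Cmod (poly (taylor f) n z - f z))).
  generalize (proj1 (H2_taylor f Hf) z Hz). rewrite is_pseries_sums, sums_lim.
  apply is_lim_seq_ext. intros n. now rewrite poly_sum_n.
Qed.

Lemma weighted_composition f : H2 f ->
  H2 (fun z => szego b z * f (tau z)) /\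
  forall n, (nsq (fun z => ((-1) * (szego b z * poly (taylor f) n (tau z)) + szego b z * f (tau z))%C)
     <= nsq (szego b) * (nsq f - sqsum (taylor f) n))%R.
Proof.
  intros Hf. set (a := taylor f).
  apply (H2_complete (fun n z => szego b z * poly a n (tau z))
           (fun n => nsq (szego b) * (nsq f - sqsum a n))%R).
  - intros n. apply poly_comp_H2.
  - intros n m Hnm. destruct (poly_comp_bound a n m Hnm) as [_ H].
    eapply Rle_trans; [exact H|]. apply Rmult_le_compat_l.
    + now apply nsq_pos, H2_szego.
    + generalize (sqsum_le_nsq f m Hf). fold a. lra.
  - replace (Finite 0) with (Finite (nsq (szego b) * (nsq f - nsq f))) by (f_equal; ring).
    apply is_lim_seq_mult'; [apply is_lim_seq_const|].
    apply is_lim_seq_minus'; [apply is_lim_seq_const|]. now apply sqsum_lim.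
  - intros z Hz.
    apply (is_lim_seq_ext (fun n => Cmod (szego b z) * Cmod (poly a n (tau z) - f (tau z))%C)%R).
    + intros n. rewrite <- Cmod_mult. f_equal. ring.
    + replace (Finite 0) with (Finite (Cmod (szego b z) * 0)) by (f_equal; ring).
      apply is_lim_seq_mult'; [apply is_lim_seq_const|]. apply poly_lim; [exact Hf|now apply Htau].
Qed.

Lemma weighted_composition_bound f : H2 f ->
  (nsq (fun z => (szego b z * f (tau z))%C) <= nsq (szego b) * nsq f)%R.
Proof.
  intros Hf. destruct (weighted_composition f Hf) as [H B]. specialize (B O).
  rewrite (nsq_ext (fun z => szego b z * f (tau z))) in B.
  - simpl in B. lra.
  - exact H.
  - intros z _. simpl. ring.
Qed.

End Composition.

(** * Density of the kernels *)

Lemma shift_contractive : contractive_multiplier (fun z => z).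
Proof.
  intros h Hh. split; [now apply H2_shift|]. unfold nsq. rewrite inner_shift by assumption. apply Rle_refl.
Qed.

Lemma H2_poly a n : H2 (poly a n).
Proof.
  apply (H2_ext (fun z => szego 0 z * poly a n z)).
  - intros z _. rewrite szego_0. ring.
  - apply (poly_comp_H2 (fun z => z)); [apply disk_0|reflexivity|apply shift_contractive].
Qed.

Lemma H2_pow n : H2 (fun z => z ^ n).
Proof.
  induction n as [|n IH]; [apply (H2_const 1)|]. exact (H2_shift _ IH).
Qed.

Lemma nsq_poly_lim f : H2 f -> is_lim_seq (fun n => nsq (fun z => ((-1) * poly (taylor f) n z + f z)%C)) 0.
Proof.
  intros Hf.
  destruct (weighted_composition (fun z => z) 0 disk_0 (fun z H => H) eq_refl shift_contractive f Hf) as [_ B].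
  apply (is_lim_seq_le_le (fun _ => 0%R) _ (fun n => nsq (szego 0) * (nsq f - sqsum (taylor f) n))%R).
  - intros n. split; [apply nsq_pos, H2_lin; [apply H2_poly|exact Hf]|].
    eapply Rle_trans; [|apply B]. right. apply nsq_ext.
    + apply H2_lin; [|apply (H2_ext f)].
      * apply (H2_ext (poly (taylor f) n)); [|apply H2_poly]. intros z _. rewrite szego_0. ring.
      * intros z _. rewrite szego_0. ring.
      * exact Hf.
    + intros z _. rewrite !szego_0. ring.
  - apply is_lim_seq_const.
  - replace (Finite 0) with (Finite (nsq (szego 0) * (nsq f - nsq f))) by (f_equal; ring).
    apply is_lim_seq_mult'; [apply is_lim_seq_const|].
    apply is_lim_seq_minus'; [apply is_lim_seq_const|]. now apply sqsum_lim.
Qed.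

(** Continuity makes [L f] the sum of [taylor f k * L (z^k)].  On kernels this
    reads as a power series in [Cconj w] that vanishes on the disk, so every
    [L (z^k)] is zero. *)
Lemma kernels_total (L : (C -> C) -> C) (B : R) :
  (forall c f g, H2 f -> H2 g -> L (fun z => c * f z + g z) = c * L f + L g) ->
  (forall f, H2 f -> Cmod (L f) ^ 2 <= B * nsq f)%R ->
  (forall w, disk w -> L (szego w) = 0) ->
  forall f, H2 f -> L f = 0.
Proof.
  intros Hlin Hbd Hker.
  assert (Hpoly : forall a n, L (poly a (S n))
            = sum_n (G := C_AbelianMonoid) (fun k => a k * L (fun z => z ^ k)) n).
  { assert (Hs : forall a n, L (poly a (S n)) = a n * L (fun z => z ^ n) + L (poly a n)).
    { intros a n. rewrite <- Hlin by (apply H2_pow || apply H2_poly). f_equal.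
      apply functional_extensionality. intros z. apply poly_snoc. }
    intros a n. induction n as [|n IH].
    - rewrite Hs, sum_O.
      assert (Z : L (poly a 0) = 0).
      { assert (E := Hlin (-1) (poly a 0) (poly a 0) (H2_poly a 0) (H2_poly a 0)).
        replace (fun z => (-1) * poly a 0 z + poly a 0 z) with (poly a 0) in E.
        - rewrite E. ring.
        - apply functional_extensionality. intros z. simpl. ring. }
      rewrite Z. ring.
    - rewrite Hs, IH, sum_Sn. change (@plus C_AbelianMonoid) with Cplus. ring. }
  assert (Hseries : forall f, H2 f -> sums (fun k => taylor f k * L (fun z => z ^ k)) (L f)).
  { intros f Hf. apply sums_lim.
    apply (is_lim_seq_Cmod2 (fun n => sum_n (G := C_AbelianMonoid) (fun k => taylor f k * L (fun z => z ^ k)) n - L f)).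
    apply (is_lim_seq_le_le (fun _ => 0%R) _
             (fun n => B * nsq (fun z => ((-1) * poly (taylor f) (S n) z + f z)%C))%R).
    - intros n. split; [apply Cmod2_pos|]. rewrite <- Hpoly.
      eapply Rle_trans; [|apply Hbd, H2_lin; [apply H2_poly|exact Hf]].
      rewrite Hlin by (apply H2_poly || assumption). rewrite <- Cmod_opp. right. do 2 f_equal. ring.
    - apply is_lim_seq_const.
    - replace (Finite 0) with (Finite (B * 0)) by (f_equal; ring).
      apply is_lim_seq_mult'; [apply is_lim_seq_const|].
      apply (is_lim_seq_incr_1 (fun n => nsq (fun z => ((-1) * poly (taylor f) n z + f z)%C))).
      now apply nsq_poly_lim. }
  assert (Hmon : forall k, L (fun z => z ^ k) = 0).
  { apply zero_series_coef. intros z Hz _.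
    assert (Hz' := disk_conj z Hz).
    generalize (Hseries _ (H2_szego _ Hz')). rewrite (Hker _ Hz').
    rewrite (taylor_unique _ _ (proj1 (H2_coef_szego _ Hz'))), Cconj_conj.
    apply sums_ext. intros n. ring. }
  intros f Hf. apply (sums_unique _ _ _ (Hseries f Hf)).
  apply (sums_ext (fun _ => 0)); [intros k; rewrite Hmon; ring|].
  apply sums_pair; apply is_series_zero.
Qed.

(** * Linear-fractional multipliers *)

Lemma nsq_affine al be g : H2 g ->
  H2 (fun z => (al * z + be) * g z) /\
  nsq (fun z => (al * z + be) * g z)
  = ((Cmod al ^ 2 + Cmod be ^ 2) * nsq g
     + 2 * Re (al * Cconj be * inner (fun z => z * g z)%C g)%C)%R.
Proof.
  intros Hg. assert (Hs := H2_shift g Hg). assert (Hbg := H2_scal be g Hg).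
  assert (E : (fun z => al * (z * g z) + be * g z) = (fun z => (al * z + be) * g z)).
  { apply functional_extensionality. intros z. ring. }
  rewrite <- E. split; [now apply (H2_lin al (fun z => z * g z) (fun z => be * g z))|].
  rewrite (nsq_lin al (fun z => z * g z) (fun z => be * g z)), nsq_scal by assumption.
  assert (E1 : nsq (fun z => z * g z) = nsq g) by (unfold nsq; now rewrite inner_shift).
  rewrite E1, inner_scal_r, Cmult_assoc by assumption. ring.
Qed.

Lemma Cmod2_affine al be z :
  (Cmod (al * z + be) ^ 2
   = Cmod al ^ 2 * Cmod z ^ 2 + Cmod be ^ 2 + 2 * Re (al * Cconj be * z)%C)%R.
Proof. rewrite !Cmod2_alt. destruct al, be, z. simpl. ring. Qed.

Lemma Cmod_sq_le x y : (0 <= y)%R -> (Cmod x ^ 2 <= y ^ 2)%R -> (Cmod x <= y)%R.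
Proof.
  intros Hy H. generalize (Cmod_ge_0 x). intros Hx.
  apply Rsqr_incr_0; try assumption. now rewrite !Rsqr_pow2.
Qed.

(** The left-hand side is approached along [z = r u] with [r -> 1], where [u]
    is the unimodular number that makes [m * u] equal to [Cmod m]. *)
Lemma affine_disk_bound (A B : R) (m : C) :
  (forall z, disk z -> A * Cmod z ^ 2 + B + 2 * Re (m * z)%C <= 0)%R ->
  (A + B + 2 * Cmod m <= 0)%R.
Proof.
  intros H.
  assert (U : exists u : C, Cmod u = 1%R /\ m * u = RtoC (Cmod m)).
  { destruct (Ceq_dec m 0) as [E|E].
    - exists 1. rewrite E, Cmod_0, Cmod_1. split; [reflexivity|ring].
    - assert (M0 : Cmod m <> 0%R) by (intros M0; apply E; now apply Cmod_eq_0).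
      assert (M1 : RtoC (Cmod m) <> 0) by (intros M1; apply M0; now apply RtoC_inj).
      exists (Cconj m / RtoC (Cmod m)). split.
      + rewrite Cmod_div, Cmod_conj, Cmod_R, Rabs_pos_eq by (exact M1 || apply Cmod_ge_0).
        now field.
      + replace (m * (Cconj m / RtoC (Cmod m))) with (m * Cconj m / RtoC (Cmod m)) by (field; exact M1).
        rewrite <- Cmod2_conj, RtoC_pow. field. exact M1. }
  destruct U as [u [Hu Hmu]].
  assert (P : forall r, (0 <= r < 1)%R -> (A * r ^ 2 + B + 2 * (r * Cmod m) <= 0)%R).
  { intros r Hr. assert (Hd : Cmod (RtoC r * u) = r).
    { rewrite Cmod_mult, Hu, Cmod_R, Rabs_pos_eq; lra. }
    specialize (H (RtoC r * u)). unfold disk in H. rewrite Hd in H.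
    replace (m * (RtoC r * u)) with (RtoC r * (m * u)) in H by ring.
    rewrite Hmu, <- RtoC_mult in H. apply H. lra. }
  destruct (Rle_or_lt (A + B + 2 * Cmod m) 0) as [|S0]; [assumption|exfalso].
  set (s := (A + B + 2 * Cmod m)%R) in *. set (k := (2 * Rabs A + 2 * Cmod m + 1)%R).
  assert (K0 : (0 < k)%R) by (unfold k; generalize (Rabs_pos A) (Cmod_ge_0 m); lra).
  set (d := Rmin 1 (s / (2 * k))).
  assert (D0 : (0 < d <= 1)%R).
  { split; [apply Rmin_glb_lt; [lra|apply Rdiv_lt_0_compat; lra]|apply Rmin_l]. }
  assert (D1 : (d * k <= s / 2)%R).
  { replace (s / 2)%R with (s / (2 * k) * k)%R by (field; lra).
    apply Rmult_le_compat_r; [lra|apply Rmin_r]. }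
  specialize (P (1 - d)%R ltac:(lra)).
  assert (Q : (A * (2 - d) + 2 * Cmod m <= k)%R).
  { unfold k. generalize (Rle_abs A) (Rabs_pos A). intros. nra. }
  assert (d * (A * (2 - d) + 2 * Cmod m) <= d * k)%R by (apply Rmult_le_compat_l; lra).
  unfold s in *. nra.
Qed.

(** Both squared norms are real-affine functions of [t = inner (z g) g], and
    [Cmod t <= nsq g] by the Cauchy-Schwarz inequality.  A real-affine function is largest on the circle, so it suffices that the difference be
    nonpositive when [t / nsq g] is unimodular, which is the hypothesis in the
    limit [|z| -> 1]. *)
Lemma affine_dominated al be ga de g :
  (forall z, disk z -> Cmod (al * z + be)%C <= Cmod (ga * z + de)%C)%R -> H2 g ->
  (nsq (fun z => ((al * z + be) * g z)%C) <= nsq (fun z => ((ga * z + de) * g z)%C))%R.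
Proof.
  intros H Hg. rewrite (proj2 (nsq_affine al be g Hg)), (proj2 (nsq_affine ga de g Hg)).
  set (t := inner (fun z => z * g z) g). set (m := al * Cconj be - ga * Cconj de).
  assert (B : ((Cmod al ^ 2 - Cmod ga ^ 2) + (Cmod be ^ 2 - Cmod de ^ 2) + 2 * Cmod m <= 0)%R).
  { apply affine_disk_bound. intros z Hz. specialize (H z Hz).
    assert (H' : (Cmod (al * z + be)%C ^ 2 <= Cmod (ga * z + de)%C ^ 2)%R).
    { apply pow_incr. split; [apply Cmod_ge_0|exact H]. }
    rewrite !Cmod2_affine in H'. unfold m.
    replace ((al * Cconj be - ga * Cconj de) * z) with (al * Cconj be * z - ga * Cconj de * z) by ring.
    replace (Re (al * Cconj be * z - ga * Cconj de * z))
      with (Re (al * Cconj be * z) - Re (ga * Cconj de * z))%R by reflexivity. lra. }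
  assert (N0 := nsq_pos g Hg).
  assert (T : (Cmod t <= nsq g)%R).
  { apply Cmod_sq_le; [exact N0|].
    eapply Rle_trans; [apply cauchy_schwarz; [now apply H2_shift|exact Hg]|].
    unfold nsq at 1. rewrite inner_shift by assumption. fold (nsq g). right. ring. }
  assert (R1 : (Re (m * t) <= Cmod m * nsq g)%R).
  { eapply Rle_trans; [apply Rle_abs|]. eapply Rle_trans; [apply re_le_Cmod|].
    rewrite Cmod_mult. apply Rmult_le_compat_l; [apply Cmod_ge_0|exact T]. }
  assert (R2 : Re (m * t) = (Re (al * Cconj be * t) - Re (ga * Cconj de * t))%R).
  { unfold m.
    replace ((al * Cconj be - ga * Cconj de) * t) with (al * Cconj be * t - ga * Cconj de * t) by ring.
    reflexivity. }
  assert (((Cmod al ^ 2 - Cmod ga ^ 2) + (Cmod be ^ 2 - Cmod de ^ 2) + 2 * Cmod m) * nsq g <= 0)%R by nra.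
  lra.
Qed.

Lemma linear_fractional_contractive al be q :
  (Cmod q < 1)%R ->
  (forall z, disk z -> Cmod (al * z + be)%C <= Cmod (1 - q * z)%C)%R ->
  contractive_multiplier (fun z => (al * z + be) / (1 - q * z)).
Proof.
  intros Hq H h Hh. destruct (H2_div q h Hq Hh) as [Hg _]. set (g := fun z => h z / (1 - q * z)) in Hg.
  assert (N : forall z, disk z -> 1 - q * z <> 0).
  { intros z Hz. apply one_minus_neq_0, Cmod_mult_lt_1; [lra|exact Hz]. }
  destruct (nsq_affine al be g Hg) as [Ha _].
  destruct (nsq_affine (- q) 1 g Hg) as [Hd _].
  assert (E : (fun z => (al * z + be) * g z) =D (fun z => (al * z + be) / (1 - q * z) * h z)).
  { intros z Hz. unfold g. field. now apply N. }
  split; [now apply (H2_ext _ _ E)|].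
  rewrite (nsq_ext _ _ Ha E).
  rewrite (nsq_ext (fun z => (- q * z + 1) * g z) h).
  - apply affine_dominated; [|exact Hg]. intros z Hz.
    replace (- q * z + 1) with (1 - q * z) by ring. now apply H.
  - exact Hd.
  - intros z Hz. unfold g. field. now apply N.
Qed.

(** If [Cmod (d1 / d0)] were at least 1, the root of [d0 + d1 z] would lie in
    the closed disk, and at [(1 - e)] times the root the value is [e * d0]. *)
Lemma affine_bounded_below d0 d1 (dl : R) : (0 < dl)%R ->
  (forall z, disk z -> dl <= Cmod (d0 + d1 * z)%C)%R -> d0 <> 0 /\ (Cmod (d1 / d0) < 1)%R.
Proof.
  intros Hdl H.
  assert (N0 : d0 <> 0).
  { intros E. specialize (H 0 disk_0). rewrite E in H.
    replace (0 + d1 * 0) with (RtoC 0) in H by ring. rewrite Cmod_0 in H. lra. }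
  split; [exact N0|].
  destruct (Rlt_or_le (Cmod (d1 / d0)) 1) as [|G]; [assumption|exfalso].
  set (t := d1 / d0) in *.
  assert (T0 : t <> 0) by (intros E; rewrite E, Cmod_0 in G; lra).
  assert (P0 : (0 < Cmod d0)%R) by now apply Cmod_gt_0.
  set (e := Rmin 1 (dl / (2 * Cmod d0))).
  assert (E0 : (0 < e <= 1)%R).
  { split; [apply Rmin_glb_lt; [lra|apply Rdiv_lt_0_compat; lra]|apply Rmin_l]. }
  assert (E1 : (e * Cmod d0 <= dl / 2)%R).
  { replace (dl / 2)%R with (dl / (2 * Cmod d0) * Cmod d0)%R by (field; lra).
    apply Rmult_le_compat_r; [lra|apply Rmin_r]. }
  specialize (H (- RtoC (1 - e) / t)).
  replace (d0 + d1 * (- RtoC (1 - e) / t)) with (RtoC e * d0) in H.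
  - rewrite Cmod_mult, Cmod_R, Rabs_pos_eq in H by lra.
    assert (dl <= e * Cmod d0)%R; [apply H|lra].
    unfold disk. rewrite Cmod_div, Cmod_opp, Cmod_R, Rabs_pos_eq by (exact T0 || lra).
    apply (Rmult_lt_reg_r (Cmod t)); [lra|]. unfold Rdiv. rewrite Rmult_assoc, Rinv_l by lra. lra.
  - rewrite RtoC_minus. replace d1 with (t * d0) by (unfold t; field; exact N0). field. exact T0.
Qed.

(** Half of the parallelogram identity: the norm of [g - c f] is nonnegative. *)
Lemma nsq_lin_le c f g : H2 f -> H2 g ->
  (nsq (fun z => (c * f z + g z)%C) <= 2 * Cmod c ^ 2 * nsq f + 2 * nsq g)%R.
Proof.
  intros Hf Hg.
  assert (P := nsq_pos _ (H2_lin (- c) f g Hf Hg)).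
  rewrite nsq_lin in P |- * by assumption. rewrite Cmod_opp in P.
  replace (Re (- c * inner f g)) with (- Re (c * inner f g))%R in P.
  - lra.
  - destruct c, (inner f g). simpl. ring.
Qed.

(** * Disk automorphisms *)

Lemma disk_auto_Cmod2 a u :
  (Cmod (1 - Cconj a * u)%C ^ 2 - Cmod (a - u)%C ^ 2 = (1 - Cmod a ^ 2) * (1 - Cmod u ^ 2))%R.
Proof. rewrite !Cmod2_alt. destruct a, u. simpl. ring. Qed.

Lemma disk_auto_num_le a u : disk a -> disk u -> (Cmod (a - u)%C < Cmod (1 - Cconj a * u)%C)%R.
Proof.
  intros Ha Hu. generalize (disk_auto_Cmod2 a u) (disk_Cmod2 a Ha) (disk_Cmod2 u Hu). intros E A U.
  assert (0 < (1 - Cmod a ^ 2) * (1 - Cmod u ^ 2))%R by (apply Rmult_lt_0_compat; lra).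
  apply Rsqr_incrst_0; try apply Cmod_ge_0. rewrite !Rsqr_pow2. lra.
Qed.

Lemma disk_auto_disk lam a u : Cmod lam = 1%R -> disk a -> disk u -> disk (disk_auto lam a u).
Proof.
  intros Hl Ha Hu. unfold disk, disk_auto.
  rewrite Cmod_mult, Hl, Rmult_1_l, Cmod_div by now apply szego_denom.
  assert (P : (0 < Cmod (1 - Cconj a * u))%R) by now apply Cmod_gt_0, szego_denom.
  apply (Rmult_lt_reg_r (Cmod (1 - Cconj a * u))); [exact P|].
  unfold Rdiv. rewrite Rmult_assoc, Rinv_l by lra. generalize (disk_auto_num_le a u Ha Hu). lra.
Qed.

Lemma disk_auto_contractive lam a : Cmod lam = 1%R -> disk a ->
  contractive_multiplier (disk_auto lam a).
Proof.
  intros Hl Ha.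
  replace (disk_auto lam a) with (fun z => (- lam * z + lam * a) / (1 - Cconj a * z)).
  - apply linear_fractional_contractive; [now rewrite Cmod_conj|].
    intros z Hz. replace (- lam * z + lam * a) with (lam * (a - z)) by ring.
    rewrite Cmod_mult, Hl, Rmult_1_l. left. now apply disk_auto_num_le.
  - apply functional_extensionality. intros z. unfold disk_auto, Cdiv. ring.
Qed.

Lemma disk_auto_zero lam a : disk_auto lam a a = 0.
Proof. unfold disk_auto, Cdiv. ring. Qed.

(** * Boundedness of linear-fractional weighted composition operators *)

(** With [a = phi 0], the involution [alpha = disk_auto 1 a] gives
    [phi = alpha o tau] with [tau 0 = 0].  For [h = szego a * (f o alpha)] one gets
    [f o phi = (1 - Cconj a tau) * (h o tau)], and each of the three operations
    (forming [h], composing with [tau], multiplying by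
    [c (1 - Cconj a tau) / (d0 + d1 z)]) is bounded. *)
Lemma linear_fractional_W_bounded psi phi n0 n1 d0 d1 c (dl : R) :
  (0 < dl)%R ->
  (forall z, disk z -> dl <= Cmod (d0 + d1 * z)%C)%R ->
  (forall z, disk z -> phi z = (n0 + n1 * z) / (d0 + d1 * z)) ->
  (forall z, disk z -> psi z = c / (d0 + d1 * z)) ->
  (forall z, disk z -> disk (phi z)) ->
  exists B : R, (0 <= B)%R /\
    forall f, H2 f -> H2 (W psi phi f) /\ (nsq (W psi phi f) <= B * nsq f)%R.
Proof.
  intros Hdl Hd Hphi Hpsi Hself.
  destruct (affine_bounded_below d0 d1 dl Hdl Hd) as [D0 Dq].
  set (a := phi 0). assert (Ha : disk a) by apply (Hself 0 disk_0).
  assert (ND : forall z, disk z -> d0 + d1 * z <> 0).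
  { intros z Hz. apply Cmod_gt_0. generalize (Hd z Hz). lra. }
  set (e0 := d0 - Cconj a * n0). set (e1 := d1 - Cconj a * n1).
  assert (Ee : forall z, disk z -> e0 + e1 * z = (d0 + d1 * z) * (1 - Cconj a * phi z)).
  { intros z Hz. rewrite Hphi by assumption. unfold e0, e1. field. now apply ND. }
  assert (He : forall z, disk z -> (dl * (1 - Cmod a) <= Cmod (e0 + e1 * z)%C)%R).
  { intros z Hz. rewrite Ee, Cmod_mult by assumption.
    assert (A0 := Cmod_ge_0 a). assert (A1 : (Cmod a < 1)%R) by exact Ha.
    apply Rmult_le_compat; try lra; [now apply Hd|].
    assert (T := Cmod_triangle (1 - Cconj a * phi z) (Cconj a * phi z)).
    replace (1 - Cconj a * phi z + Cconj a * phi z) with (RtoC 1) in T by ring.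
    rewrite Cmod_1, Cmod_mult, Cmod_conj in T.
    assert (Cmod a * Cmod (phi z) <= Cmod a * 1)%R.
    { apply Rmult_le_compat_l; [exact A0|]. left. now apply Hself. }
    lra. }
  destruct (affine_bounded_below e0 e1 (dl * (1 - Cmod a))%R) as [E0 Eq].
  { apply Rmult_lt_0_compat; [lra|]. unfold disk in Ha. lra. }
  { exact He. }
  (* [tau] is [disk_auto 1 a o phi] with its denominator normalized to value 1 at 0. *)
  set (tau := fun z => ((a * d1 - n1) / e0 * z + (a * d0 - n0) / e0) / (1 - - (e1 / e0) * z)).
  assert (NE : forall z, disk z -> e0 + e1 * z <> 0).
  { intros z Hz. rewrite Ee by assumption. apply Cmult_neq_0; [now apply ND|].
    apply szego_denom; [exact Ha|now apply Hself]. }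
  assert (NE' : forall z, disk z -> 1 - - (e1 / e0) * z <> 0).
  { intros z Hz. replace (1 - - (e1 / e0) * z) with ((e0 + e1 * z) / e0) by (field; exact E0).
    intros E. apply (NE z Hz). replace (e0 + e1 * z) with ((e0 + e1 * z) / e0 * e0) by (field; exact E0).
    rewrite E. ring. }
  assert (Et : forall z, disk z -> tau z = disk_auto 1 a (phi z)).
  { intros z Hz. assert (N1 := ND z Hz). assert (N2 := NE z Hz).
    assert (N3 := szego_denom a (phi z) Ha (Hself z Hz)). 
    unfold disk_auto. rewrite Cmult_1_l.
    transitivity ((a - phi z) * (d0 + d1 * z) / (e0 + e1 * z)).
    - rewrite Hphi by assumption. unfold tau. field. split; [exact N1|split; [|exact E0]]. exact N2.
    - rewrite Ee by assumption. field. now split. }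
  assert (Ht : forall z, disk z -> disk (tau z)).
  { intros z Hz. rewrite Et by assumption. apply disk_auto_disk; [apply Cmod_1|exact Ha|now apply Hself]. }
  assert (Ht0 : tau 0 = 0).
  { rewrite (Et 0 disk_0). fold a. apply disk_auto_zero. }
  assert (Htm : contractive_multiplier tau).
  { apply linear_fractional_contractive; [now rewrite Cmod_opp|].
    intros z Hz. assert (Hz' : (Cmod (tau z) < 1)%R) by now apply Ht.
    unfold tau in Hz'. rewrite Cmod_div in Hz' by now apply NE'.
    assert (P : (0 < Cmod (1 - - (e1 / e0) * z))%R) by now apply Cmod_gt_0, NE'.
    apply (Rmult_le_reg_r (/ Cmod (1 - - (e1 / e0) * z))); [now apply Rinv_0_lt_compat|].
    rewrite Rinv_r by lra. left. exact Hz'. }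
  assert (K1 := nsq_pos _ (H2_szego a Ha)). assert (K0 := nsq_pos _ (H2_szego 0 disk_0)).
  exists (Cmod (c / d0) ^ 2 * (/ (1 - Cmod (- (d1 / d0))) ^ 2 * (4 * (nsq (szego 0) * nsq (szego a)))))%R.
  split.
  { repeat apply Rmult_le_pos; try lra; try apply Cmod_ge_0.
    left. apply Rinv_0_lt_compat, pow_lt. rewrite Cmod_opp. lra. }
  intros f Hf.
  destruct (weighted_composition (disk_auto 1 a) a Ha
      (fun z Hz => disk_auto_disk 1 a z Cmod_1 Ha Hz) (disk_auto_zero 1 a)
      (disk_auto_contractive 1 a Cmod_1 Ha) f Hf) as [Hh _].
  assert (Bh := weighted_composition_bound (disk_auto 1 a) a Ha
      (fun z Hz => disk_auto_disk 1 a z Cmod_1 Ha Hz) (disk_auto_zero 1 a)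
      (disk_auto_contractive 1 a Cmod_1 Ha) f Hf).
  set (h := fun z => szego a z * f (disk_auto 1 a z)) in Hh, Bh.
  destruct (weighted_composition tau 0 disk_0 Ht Ht0 Htm h Hh) as [Hk _].
  assert (Bk := weighted_composition_bound tau 0 disk_0 Ht Ht0 Htm h Hh).
  set (k := fun z => szego 0 z * h (tau z)) in Hk, Bk.
  destruct (Htm k Hk) as [Htk Btk].
  assert (Hu := H2_lin (- Cconj a) _ _ Htk Hk).
  assert (Bu := nsq_lin_le (- Cconj a) _ _ Htk Hk).
  set (u := fun z => - Cconj a * (tau z * k z) + k z) in Hu, Bu.
  destruct (H2_div (- (d1 / d0)) u ltac:(now rewrite Cmod_opp) Hu) as [Hv Bv].
  set (v := fun z => u z / (1 - - (d1 / d0) * z)) in Hv, Bv.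
  assert (Hw := H2_scal (c / d0) v Hv).
  assert (E : (fun z => c / d0 * v z) =D W psi phi f).
  { intros z Hz. assert (N1 := ND z Hz). unfold v, u, k, h, W. rewrite szego_0.
    assert (Inv : disk_auto 1 a (tau z) = phi z).
    { rewrite Et by assumption.
      assert (N3 := szego_denom a (phi z) Ha (Hself z Hz)).
      assert (N4 := szego_denom a a Ha Ha).
      unfold disk_auto. rewrite !Cmult_1_l. field. split; [exact N3|].
      replace (1 - Cconj a * phi z - Cconj a * (a - phi z)) with (1 - Cconj a * a) by ring. exact N4. }
    rewrite Inv, Hpsi by assumption. unfold szego.
    assert (N5 := szego_denom a (tau z) Ha (Ht z Hz)).
    field. repeat split; assumption. }
  split; [now apply (H2_ext _ _ E)|].
  rewrite (nsq_ext _ _ Hw E), nsq_scal by assumption.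
  rewrite Rmult_assoc. apply Rmult_le_compat_l; [apply Cmod2_pos|].
  eapply Rle_trans; [exact Bv|]. rewrite Rmult_assoc. apply Rmult_le_compat_l.
  { left. apply Rinv_0_lt_compat, pow_lt. rewrite Cmod_opp. lra. }
  rewrite Cmod_opp, Cmod_conj in Bu.
  assert (A2 := disk_Cmod2 a Ha). assert (Pk := nsq_pos _ Htk).
  assert (Cmod a ^ 2 * nsq (fun z => (tau z * k z)%C) <= 1 * nsq (fun z => (tau z * k z)%C))%R.
  { apply Rmult_le_compat_r; lra. }
  assert (nsq (szego 0) * nsq h <= nsq (szego 0) * (nsq (szego a) * nsq f))%R.
  { now apply Rmult_le_compat_l. }
  lra.
Qed.

(** * The conjugation and complex symmetry *)

Lemma conjugation_nsq K f : conjugation K -> H2 f -> nsq (K f) = nsq f.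
Proof.
  intros [HK [_ [Hn _]]] Hf. specialize (Hn f Hf). rewrite !normH2_nsq in Hn.
  apply sqrt_inj in Hn; [exact Hn|now apply nsq_pos, HK|now apply nsq_pos].
Qed.

(** Polarization: applying the isometry to [c f + g] for [c = 1] and [c = i]
    recovers the real and imaginary parts. *)
Lemma conjugation_inner K f g : conjugation K -> H2 f -> H2 g ->
  inner (K f) (K g) = Cconj (inner f g).
Proof.
  intros HC Hf Hg. assert (Hn := fun h Hh => conjugation_nsq K h HC Hh).
  destruct HC as [HK [Hl _]].
  assert (P : forall c, Re (Cconj c * inner (K f) (K g)) = Re (c * inner f g)).
  { intros c. assert (E := Hn _ (H2_lin c f g Hf Hg)).
    rewrite <- (nsq_ext _ _ (HK _ (H2_lin c f g Hf Hg)) (Hl c f g Hf Hg)) in E.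
    rewrite !nsq_lin, Cmod_conj, !Hn in E by (assumption || now apply HK). lra. }
  generalize (P 1) (P Ci). destruct (inner (K f) (K g)) as [x y], (inner f g) as [x' y'].
  simpl. intros E1 E2. unfold Cconj. simpl. f_equal; lra.
Qed.

Section Symbol.

Variables (p lam : C).
Hypothesis Hp : disk p.
Hypothesis Hlam : Cmod lam = 1%R.
Hypothesis Hlamp : lam * p = Cconj p.

Definition conj_op (f : C -> C) : C -> C := J (W (kernel p) (disk_auto lam p) f).

(** Up to the constant [s_p], [1 / den w] is the image of [szego w] under the
    conjugation; see [conj_op_szego]. *)
Definition den (w z : C) : C := 1 - w * p - (p - Cconj lam * w) * z.

Lemma lam_conj : lam * Cconj lam = 1.
Proof. rewrite <- Cmod2_conj, Hlam. simpl. f_equal. ring. Qed.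

Lemma conj_lam_conj_p : Cconj lam * Cconj p = p.
Proof.
  rewrite <- Hlamp. replace (Cconj lam * (lam * p)) with (lam * Cconj lam * p) by ring.
  rewrite lam_conj. ring.
Qed.

Lemma den_sym w z : den w z = den z w.
Proof. unfold den. ring. Qed.

Lemma den_factor w z : den w z = (1 - p * z) - w * (Cconj lam * (Cconj p - z)).
Proof.
  unfold den. replace (w * (Cconj lam * (Cconj p - z))) with (w * (Cconj lam * Cconj p - Cconj lam * z)) by ring.
  rewrite conj_lam_conj_p. ring.
Qed.

Lemma one_minus_pz z : disk z -> 1 - p * z <> 0.
Proof.
  intros Hz. generalize (szego_denom _ z (disk_conj p Hp) Hz). now rewrite Cconj_conj.
Qed.

Lemma conj_disk_auto z : disk z ->
  Cconj (disk_auto lam p (Cconj z)) = Cconj lam * (Cconj p - z) / (1 - p * z).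
Proof.
  intros Hz. assert (N := szego_denom p _ Hp (disk_conj z Hz)).
  unfold disk_auto. rewrite Cmult_conj, Cdiv_conj, !Cminus_conj, Cmult_conj, !Cconj_conj, Cconj_RtoC by exact N.
  field. now apply one_minus_pz.
Qed.

Lemma den_neq_0 w z : disk w -> disk z -> den w z <> 0.
Proof.
  intros Hw Hz.
  set (s := Cconj (disk_auto lam p (Cconj z))).
  assert (Hs : disk s) by now apply disk_conj, disk_auto_disk, disk_conj.
  assert (N := one_minus_pz z Hz).
  replace (den w z) with ((1 - p * z) * (1 - w * s)).
  - apply Cmult_neq_0; [exact N|]. generalize (szego_denom _ s (disk_conj w Hw) Hs).
    now rewrite Cconj_conj.
  - rewrite den_factor. unfold s. rewrite conj_disk_auto by exact Hz. field. exact N.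
Qed.

Definition s_p : R := sqrt (1 - Cmod p ^ 2).

Lemma s_p_sq : (s_p ^ 2 = 1 - Cmod p ^ 2)%R.
Proof. unfold s_p. apply pow2_sqrt. generalize (disk_Cmod2 p Hp). lra. Qed.

Lemma s_p_sq_C : RtoC s_p * RtoC s_p = 1 - p * Cconj p.
Proof.
  rewrite <- Cmod2_conj, <- RtoC_minus, <- RtoC_mult, <- s_p_sq. f_equal. ring.
Qed.

Lemma s_p_neq_0 : RtoC s_p <> 0.
Proof.
  intros E. apply RtoC_inj in E. generalize s_p_sq (disk_Cmod2 p Hp). rewrite E. simpl. lra.
Qed.

(** The factor [s_p] normalizes [szego p], so the bound of
    [weighted_composition_bound] becomes 1. *)
Lemma W_kernel_contractive f : H2 f ->
  H2 (W (kernel p) (disk_auto lam p) f) /\ (nsq (W (kernel p) (disk_auto lam p) f) <= nsq f)%R.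
Proof.
  intros Hf.
  assert (Hd : forall z, disk z -> disk (disk_auto lam p z)) by (intros z; now apply disk_auto_disk).
  assert (Hm := disk_auto_contractive lam p Hlam Hp).
  destruct (weighted_composition _ p Hp Hd (disk_auto_zero lam p) Hm f Hf) as [H _].
  assert (B := weighted_composition_bound _ p Hp Hd (disk_auto_zero lam p) Hm f Hf).
  assert (E : (fun z => RtoC s_p * (szego p z * f (disk_auto lam p z))) =D W (kernel p) (disk_auto lam p) f).
  { intros z _. unfold W, kernel, szego, Cdiv. fold s_p. ring. }
  split.
  - apply (H2_ext _ _ E). now apply H2_scal.
  - rewrite (nsq_ext _ _ (H2_scal _ _ H) E), nsq_scal by exact H.
    rewrite nsq_szego in B by exact Hp.
    rewrite Cmod_R, <- Rsqr_pow2, <- Rsqr_abs, Rsqr_pow2, s_p_sq.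
    assert (D := disk_Cmod2 p Hp).
    replace (nsq f) with ((1 - Cmod p ^ 2) * (/ (1 - Cmod p ^ 2) * nsq f))%R by (field; lra).
    apply Rmult_le_compat_l; [lra|exact B].
Qed.

Lemma conj_op_H2 f : H2 f -> H2 (conj_op f).
Proof. intros Hf. eapply H2_coef_H2. apply J_spec. now apply W_kernel_contractive. Qed.

Lemma conj_op_le f : H2 f -> (nsq (conj_op f) <= nsq f)%R.
Proof.
  intros Hf. destruct (W_kernel_contractive f Hf) as [H B].
  unfold conj_op. rewrite (proj2 (proj2 (J_spec _ H))). exact B.
Qed.

Lemma conj_op_eval f z : H2 f -> disk z ->
  conj_op f z = RtoC s_p / (1 - p * z) * Cconj (f (disk_auto lam p (Cconj z))).
Proof.
  intros Hf Hz. unfold conj_op.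
  rewrite (proj1 (proj2 (J_spec _ (proj1 (W_kernel_contractive f Hf))))) by exact Hz.
  unfold W, kernel. fold s_p.
  assert (N := szego_denom p _ Hp (disk_conj z Hz)).
  now rewrite Cmult_conj, Cdiv_conj, Cminus_conj, Cmult_conj, !Cconj_conj, !Cconj_RtoC by exact N.
Qed.

Lemma conj_op_ext f g : H2 f -> f =D g -> conj_op f =D conj_op g.
Proof.
  intros Hf E z Hz. rewrite !conj_op_eval; try assumption; [|now apply (H2_ext f)].
  rewrite (E (disk_auto lam p (Cconj z))); [reflexivity|].
  apply disk_auto_disk; try assumption. now apply disk_conj.
Qed.

Lemma conj_op_lin c f g : H2 f -> H2 g ->
  conj_op (fun z => c * f z + g z) =D (fun z => Cconj c * conj_op f z + conj_op g z).
Proof.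
  intros Hf Hg z Hz. rewrite !conj_op_eval; try assumption; [|now apply H2_lin].
  rewrite Cplus_conj, Cmult_conj. ring.
Qed.

Lemma conj_op_invol f : H2 f -> conj_op (conj_op f) =D f.
Proof.
  intros Hf z Hz. set (u := disk_auto lam p (Cconj z)).
  assert (Hu : disk u) by now apply disk_auto_disk, disk_conj.
  assert (N := one_minus_pz z Hz). assert (N' := one_minus_pz u Hu).
  assert (Npp := one_minus_pz _ (disk_conj p Hp)).
  rewrite (conj_op_eval (conj_op f)); [|now apply conj_op_H2|exact Hz].
  fold u. rewrite (conj_op_eval f u Hf Hu).
  rewrite Cmult_conj, Cdiv_conj, Cminus_conj, Cmult_conj, !Cconj_conj, !Cconj_RtoC by exact N'.
  assert (Eu : Cconj u = Cconj lam * (Cconj p - z) / (1 - p * z)) by now apply conj_disk_auto.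
  assert (Ek : 1 - Cconj p * Cconj u = (1 - p * Cconj p) / (1 - p * z)).
  { rewrite Eu. replace (Cconj p * (Cconj lam * (Cconj p - z) / (1 - p * z)))
      with (Cconj lam * Cconj p * (Cconj p - z) / (1 - p * z)) by (field; exact N).
    rewrite conj_lam_conj_p. field. exact N. }
  assert (Einv : disk_auto lam p (Cconj u) = z).
  { unfold disk_auto. rewrite Ek, Eu.
    replace (p - Cconj lam * (Cconj p - z) / (1 - p * z))
      with (Cconj lam * (z * (1 - p * Cconj p)) / (1 - p * z)).
    - transitivity (lam * Cconj lam * z); [field; now split|]. rewrite lam_conj. ring.
    - replace (Cconj lam * (Cconj p - z)) with (Cconj lam * Cconj p - Cconj lam * z) by ring.
      rewrite conj_lam_conj_p.
      transitivity ((Cconj lam * z - Cconj lam * Cconj p * (p * z)) / (1 - p * z)); [field; exact N|].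
      rewrite conj_lam_conj_p. field. exact N. }
  rewrite Einv, Ek.
  transitivity (RtoC s_p * RtoC s_p / (1 - p * Cconj p) * f z); [field; now split|].
  rewrite s_p_sq_C. field. exact Npp.
Qed.

(** A contraction which is an involution: the norm of
    [f = conj_op (conj_op f)] is at most that of [conj_op f]. *)
Lemma conj_op_conjugation : conjugation conj_op.
Proof.
  split; [exact conj_op_H2|split; [exact conj_op_lin|split; [|exact conj_op_invol]]].
  intros f Hf. rewrite !normH2_nsq. f_equal. apply Rle_antisym; [now apply conj_op_le|].
  assert (H := conj_op_H2 f Hf).
  rewrite (nsq_ext _ _ (conj_op_H2 _ H) (conj_op_invol f Hf)). now apply conj_op_le.
Qed.

Lemma conj_op_szego w z : disk w -> disk z -> conj_op (szego w) z = RtoC s_p / den w z.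
Proof.
  intros Hw Hz. rewrite conj_op_eval by (try assumption; now apply H2_szego).
  assert (Hu : disk (disk_auto lam p (Cconj z))) by now apply disk_auto_disk, disk_conj.
  assert (N := one_minus_pz z Hz).
  assert (N2 := den_neq_0 w z Hw Hz). rewrite den_factor in N2 |- *.
  unfold szego. rewrite Cinv_conj by now apply szego_denom.
  rewrite Cminus_conj, Cmult_conj, Cconj_conj, Cconj_RtoC, conj_disk_auto by exact Hz.
  field. split; [exact N2|exact N].
Qed.

Section Operator.

Variables (psi phi : C -> C).
Hypothesis Hself : forall z, disk z -> disk (phi z).

Definition symmetric_symbols : Prop :=
  forall v w, disk v -> disk w -> psi v * den v (phi w) = psi w * den w (phi v).

(** Evaluation at [v] is the inner product with [szego v = K (K (szego v))].
    Moving [W psi phi] across with its adjoint and the isometry [K] off both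
    arguments exchanges the roles of [v] and [w]. *)
Lemma complex_symmetric_symbols :
  complex_symmetric conj_op (W psi phi) -> symmetric_symbols.
Proof.
  intros [HK [[HW _] [S [[HS Hadj] Hsym]]]] v w Hv Hw.
  assert (HE : forall x, disk x -> H2 (conj_op (szego x))).
  { intros x Hx. now apply conj_op_H2, H2_szego. }
  assert (HWE : forall x, disk x -> H2 (W psi phi (conj_op (szego x)))) by (intros x Hx; now apply HW, HE).
  assert (E : W psi phi (conj_op (szego w)) v = W psi phi (conj_op (szego v)) w).
  { rewrite <- (inner_szego _ v), <- (inner_szego (W psi phi (conj_op (szego v))) w) by auto.
    transitivity (inner (W psi phi (conj_op (szego w))) (conj_op (conj_op (szego v)))).
    { apply inner_ext; [now apply HWE|now apply conj_op_H2, HE|easy|].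
      apply conj_op_invol. now apply H2_szego. }
    rewrite Hadj by auto using conj_op_H2.
    transitivity (inner (conj_op (szego w)) (conj_op (W psi phi (conj_op (szego v))))).
    { apply inner_ext; [now apply HE|now apply conj_op_H2, HWE|easy|]. now apply Hsym, HE. }
    rewrite conjugation_inner by auto using H2_szego.
    symmetry. apply inner_conj; auto using H2_szego. }
  unfold W in E. rewrite !conj_op_szego in E by auto.
  assert (N1 := den_neq_0 w (phi v) Hw (Hself v Hv)).
  assert (N2 := den_neq_0 v (phi w) Hv (Hself w Hw)).
  assert (S0 := s_p_neq_0).
  transitivity (psi v * (RtoC s_p / den w (phi v)) * (den w (phi v) * den v (phi w) / RtoC s_p)).
  - field. now split.
  - rewrite E. field. now split.
Qed.

(** Expansion of the affine function [den v] around [a0]; by symmetry of [den],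
    its value there is the common denominator [den a0 v] of [psi] and [phi]. *)
Lemma den_split v u a0 : den v u = den a0 v - (p - Cconj lam * v) * (u - a0).
Proof. unfold den. ring. Qed.

Lemma symmetric_symbols_form :
  (exists z, disk z /\ psi z <> 0) -> symmetric_symbols ->
  exists a0 a1 c : C, forall z : C, disk z ->
    den a0 z <> 0 /\ psi z = c / den a0 z /\
    phi z = a0 + a1 * (p - Cconj lam * z) / den a0 z.
Proof.
  intros [z0 [Hz0 Hpz0]] Hsym.
  assert (Hq := disk_conj p Hp). set (a0 := phi (Cconj p)).
  assert (Ha0 : disk a0) by now apply Hself.
  assert (ND : forall z, disk z -> den a0 z <> 0) by (intros z Hz; now apply den_neq_0).
  set (c := psi (Cconj p) * (1 - p * Cconj p)).
  assert (Hc : forall v, disk v -> psi v * den a0 v = c).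
  { intros v Hv. rewrite den_sym. unfold a0. rewrite (Hsym v _ Hv Hq). unfold c, den.
    rewrite conj_lam_conj_p. ring. }
  assert (Hpsi : forall v, disk v -> psi v = c / den a0 v).
  { intros v Hv. rewrite <- (Hc v Hv). field. now apply ND. }
  assert (C0 : c <> 0).
  { rewrite <- (Hc z0 Hz0). apply Cmult_neq_0; [exact Hpz0|now apply ND]. }
  assert (Hv : exists v, disk v /\ p - Cconj lam * v <> 0).
  { destruct (Ceq_dec p 0) as [E|E].
    - exists (RtoC (1 / 2)). split; [apply RtoC_disk; lra|]. rewrite E. intros E'.
      assert (X : lam * Cconj lam * RtoC (1 / 2) = 0).
      { transitivity (- lam * (0 - Cconj lam * RtoC (1 / 2))); [ring|]. rewrite E'. ring. }
      rewrite lam_conj, Cmult_1_l in X. apply RtoC_inj in X. lra.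
    - exists 0. split; [apply disk_0|]. now replace (p - Cconj lam * 0) with p by ring. }
  (* Any admissible [v] serves: the equation makes the quotient below independent of it. *)
  destruct Hv as [v [Hv Nv]].
  exists a0, (den a0 v * (phi v - a0) / (p - Cconj lam * v)), c.
  intros w Hw. split; [now apply ND|]. split; [now apply Hpsi|].
  assert (Nw := ND w Hw). assert (Ndv := ND v Hv).
  assert (E := Hsym v w Hv Hw). rewrite !Hpsi, (den_split v (phi w) a0), (den_split w (phi v) a0) in E by assumption.
  assert (E2 : den a0 w * ((p - Cconj lam * v) * (phi w - a0))
             = den a0 v * ((p - Cconj lam * w) * (phi v - a0))).
  { transitivity (den a0 w * den a0 v
       - den a0 w * den a0 v / c * (c / den a0 v * (den a0 v - (p - Cconj lam * v) * (phi w - a0)))).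
    - field. now split.
    - rewrite E. field. now split. }
  transitivity (a0 + den a0 w * ((p - Cconj lam * v) * (phi w - a0))
                      / (den a0 w * (p - Cconj lam * v))).
  - field. now split.
  - rewrite E2. field. now split.
Qed.

Lemma form_symmetric_symbols a0 a1 c :
  (forall z : C, disk z ->
    den a0 z <> 0 /\ psi z = c / den a0 z /\
    phi z = a0 + a1 * (p - Cconj lam * z) / den a0 z) -> symmetric_symbols.
Proof.
  intros H v w Hv Hw.
  destruct (H v Hv) as [Nv [Pv Fv]]. destruct (H w Hw) as [Nw [Pw Fw]].
  rewrite (den_split v _ a0), (den_split w _ a0), Pv, Pw, Fv, Fw. field. now split.
Qed.

(** Since [psi = c / den a0] is bounded and [c <> 0], the denominator stays away
    from 0 on the disk, as [linear_fractional_W_bounded] requires. *)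
Lemma form_W_bounded a0 a1 c (M : R) :
  (exists z, disk z /\ psi z <> 0) ->
  (forall z, disk z -> Cmod (psi z) <= M)%R ->
  (forall z : C, disk z ->
    den a0 z <> 0 /\ psi z = c / den a0 z /\
    phi z = a0 + a1 * (p - Cconj lam * z) / den a0 z) ->
  exists B : R, (0 <= B)%R /\
    forall f, H2 f -> H2 (W psi phi f) /\ (nsq (W psi phi f) <= B * nsq f)%R.
Proof.
  intros [z0 [Hz0 Hpz0]] HM H.
  assert (C0 : c <> 0).
  { intros E. apply Hpz0. rewrite (proj1 (proj2 (H z0 Hz0))), E. unfold Cdiv. ring. }
  assert (M0 : (0 < M)%R).
  { eapply Rlt_le_trans; [|apply (HM z0 Hz0)]. now apply Cmod_gt_0. }
  assert (P0 : (0 < Cmod c)%R) by now apply Cmod_gt_0.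
  assert (ED : forall z, 1 - a0 * p + - (p - Cconj lam * a0) * z = den a0 z) by (intros z; unfold den; ring).
  apply (linear_fractional_W_bounded psi phi
           (a0 * (1 - a0 * p) + a1 * p) (- (a0 * (p - Cconj lam * a0)) - a1 * Cconj lam)
           (1 - a0 * p) (- (p - Cconj lam * a0)) c (Cmod c / M)).
  - now apply Rdiv_lt_0_compat.
  - intros z Hz. rewrite ED. destruct (H z Hz) as [N [P _]].
    specialize (HM z Hz). rewrite P, Cmod_div in HM by exact N.
    assert (D0 : (0 < Cmod (den a0 z))%R) by now apply Cmod_gt_0.
    apply (Rmult_le_reg_r M); [exact M0|]. unfold Rdiv. rewrite Rmult_assoc, Rinv_l, Rmult_1_r by lra.
    apply (Rmult_le_compat_r (Cmod (den a0 z))) in HM; [|lra].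
    unfold Rdiv in HM. rewrite Rmult_assoc, Rinv_l in HM by lra. lra.
  - intros z Hz. rewrite ED. destruct (H z Hz) as [N [_ P]]. rewrite P.
    replace (a0 * (1 - a0 * p) + a1 * p + (- (a0 * (p - Cconj lam * a0)) - a1 * Cconj lam) * z)
      with (a0 * den a0 z + a1 * (p - Cconj lam * z)) by (unfold den; ring).
    field. exact N.
  - intros z Hz. rewrite ED. now apply H.
  - exact Hself.
Qed.

Lemma W_lin (a : C) f g :
  W psi phi (fun z => a * f z + g z) =D (fun z => a * W psi phi f z + W psi phi g z).
Proof. intros z _. unfold W. ring. Qed.

(** The functional equation says that [W psi phi] maps [K (szego w)] to
    [psi w * K (szego (phi w))].  Hence [S = K (W psi phi) K] maps [szego w] to
    [Cconj (psi w) * szego (phi w)], as the adjoint must; kernels being total,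
    [S] is the adjoint.  The symmetry relation is then [K K = 1]. *)
Lemma symmetric_symbols_complex_symmetric (B : R) :
  (0 <= B)%R ->
  (forall f, H2 f -> H2 (W psi phi f) /\ (nsq (W psi phi f) <= B * nsq f)%R) ->
  symmetric_symbols -> complex_symmetric conj_op (W psi phi).
Proof.
  intros B0 HB Hsym.
  assert (HW : forall f, H2 f -> H2 (W psi phi f)) by (intros f Hf; now apply HB).
  assert (WE : forall w, disk w ->
            W psi phi (conj_op (szego w)) =D (fun z => psi w * conj_op (szego (phi w)) z)).
  { intros w Hw z Hz. unfold W. rewrite !conj_op_szego by auto.
    assert (N1 := den_neq_0 w (phi z) Hw (Hself z Hz)).
    assert (N2 := den_neq_0 (phi w) z (Hself w Hw) Hz).
    transitivity (psi z * den z (phi w) * RtoC s_p / (den w (phi z) * den (phi w) z)).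
    - rewrite (den_sym z). field. now split.
    - rewrite (Hsym z w Hz Hw). field. now split. }
  set (S := fun f => conj_op (W psi phi (conj_op f))).
  assert (HS : forall f, H2 f -> H2 (S f)) by (intros f Hf; now apply conj_op_H2, HW, conj_op_H2).
  assert (BS : forall f, H2 f -> (nsq (S f) <= B * nsq f)%R).
  { intros f Hf. assert (Hc := conj_op_H2 f Hf).
    eapply Rle_trans; [now apply conj_op_le, HW|]. eapply Rle_trans; [now apply HB|].
    apply Rmult_le_compat_l; [exact B0|now apply conj_op_le]. }
  assert (Slin : forall c f g, H2 f -> H2 g -> S (fun z => c * f z + g z) =D (fun z => c * S f z + S g z)).
  { intros c f g Hf Hg z Hz. unfold S.
    assert (Hcf := conj_op_H2 f Hf). assert (Hcg := conj_op_H2 g Hg).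
    transitivity (conj_op (fun z => Cconj c * W psi phi (conj_op f) z + W psi phi (conj_op g) z) z).
    - apply conj_op_ext; [now apply HW, conj_op_H2, H2_lin| |exact Hz].
      intros x Hx. rewrite <- (W_lin (Cconj c) (conj_op f) (conj_op g) x Hx).
      unfold W. f_equal. apply conj_op_lin; auto.
    - rewrite conj_op_lin by auto. now rewrite Cconj_conj. }
  assert (Sszego : forall w, disk w -> S (szego w) =D (fun z => Cconj (psi w) * szego (phi w) z)).
  { intros w Hw z Hz. unfold S. assert (Hk := H2_szego _ (Hself w Hw)). assert (Hc := conj_op_H2 _ Hk).
    assert (Hkw := H2_szego w Hw).
    rewrite (conj_op_ext _ _ (HW _ (conj_op_H2 _ Hkw)) (WE w Hw) z Hz).
    assert (H0 := H2_zero).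
    transitivity (conj_op (fun z => (psi w - 1) * conj_op (szego (phi w)) z + conj_op (szego (phi w)) z) z).
    - apply conj_op_ext; [now apply H2_scal| |exact Hz]. intros x _. ring.
    - rewrite conj_op_lin, conj_op_invol, Cminus_conj, Cconj_RtoC by auto. ring. }
  split; [exact conj_op_conjugation|]. split.
  - split; [exact HW|]. split; [intros a f g _ _; apply W_lin|].
    exists (sqrt B). intros f Hf. rewrite !normH2_nsq, <- sqrt_mult_alt by exact B0.
    apply sqrt_le_1_alt. now apply HB.
  - exists S. split.
    + split; [exact HS|]. intros f g Hf Hg.
      assert (HWf := HW f Hf).
      set (L := fun g => Cconj (inner (W psi phi f) g - inner f (S g))).
      assert (L0 : L g = 0).
      { apply (kernels_total L (2 * nsq (W psi phi f) + 2 * (nsq f * B))%R); [| | |exact Hg].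
        - intros c h k Hh Hk. unfold L. rewrite inner_lin_r by assumption.
          rewrite (inner_ext f f (fun z => c * S h z + S k z) (S (fun z => c * h z + k z))); try easy.
          + rewrite inner_lin_r by auto.
            rewrite !Cminus_conj, !Cplus_conj, !Cmult_conj, Cconj_conj. ring.
          + apply H2_lin; auto.
          + apply eq_on_disk_sym. now apply Slin.
        - intros h Hh. unfold L. rewrite Cmod_conj.
          unfold Cminus. eapply Rle_trans; [apply Cmod2_plus_le|]. rewrite Cmod_opp.
          assert (B1 := cauchy_schwarz (W psi phi f) h HWf Hh).
          assert (B2 := cauchy_schwarz f (S h) Hf (HS h Hh)).
          assert (B3 : (nsq f * nsq (S h) <= nsq f * (B * nsq h))%R).
          { apply Rmult_le_compat_l; [now apply nsq_pos|now apply BS]. }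
          lra.
        - intros w Hw. unfold L. rewrite inner_szego by assumption.
          assert (Hk := H2_szego _ (Hself w Hw)).
          rewrite (inner_ext f f (fun z => Cconj (psi w) * szego (phi w) z) (S (szego w))); try easy.
          + rewrite inner_scal_r, inner_szego, Cconj_conj by auto. unfold W.
            replace (psi w * f (phi w) - psi w * f (phi w)) with (RtoC 0) by ring. apply Cconj_RtoC.
          + now apply H2_scal.
          + apply eq_on_disk_sym. now apply Sszego. }
      unfold L in L0. apply (f_equal Cconj) in L0. rewrite Cconj_conj, Cconj_RtoC in L0.
      replace (inner (W psi phi f) g)
        with ((inner (W psi phi f) g - inner f (S g)) + inner f (S g)) by ring.
      rewrite L0. ring.
    + intros f Hf. unfold S. apply conj_op_ext; [now apply HW|].
      intros z Hz. unfold W. f_equal. symmetry. apply conj_op_invol; auto.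
Qed.

End Operator.
End Symbol.

Theorem theorem1 (phi psi : C -> C) (p lam : C)
  (Hphi : holomorphic_self_map phi)
  (Hpsi : Hinfty psi)
  (Hpsi_nonzero : exists z : C, disk z /\ psi z <> 0)
  (Hp : disk p)
  (Hlam : Cmod lam = 1%R)
  (Hlamp : lam * p = Cconj p) :
  complex_symmetric (fun f => J (W (kernel p) (disk_auto lam p) f)) (W psi phi) <->
  exists a0 a1 c : C, forall z : C, disk z ->
    1 - a0 * p - (p - Cconj lam * a0) * z <> 0 /\
    psi z = c / (1 - a0 * p - (p - Cconj lam * a0) * z) /\
    phi z = a0 + a1 * (p - Cconj lam * z)
                 / (1 - a0 * p - (p - Cconj lam * a0) * z).
Proof.
  destruct Hphi as [_ Hself]. destruct Hpsi as [_ [M HM]].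
  change (complex_symmetric (conj_op p lam) (W psi phi) <->
    exists a0 a1 c : C, forall z : C, disk z ->
      den p lam a0 z <> 0 /\ psi z = c / den p lam a0 z /\
      phi z = a0 + a1 * (p - Cconj lam * z) / den p lam a0 z).
  split.
  - intros H. apply symmetric_symbols_form; try assumption.
    now apply complex_symmetric_symbols.
  - intros [a0 [a1 [c H]]].
    destruct (form_W_bounded p lam psi phi Hself a0 a1 c M Hpsi_nonzero HM H) as [B [B0 HB]].
    apply (symmetric_symbols_complex_symmetric p lam Hp Hlam Hlamp psi phi Hself B B0 HB).
    now apply (form_symmetric_symbols p lam psi phi a0 a1 c).
Qed.
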